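(* Let $X_1,X_2$ be compact metrizable spaces and let $H:\mathfrak C[X_1]\times\mathfrak C[X_2]\to[0,+\infty)$ be continuous, radially $1$-homogeneous and radially convex. Assume that there exists an open set $\Omega_H\subset X_1\times X_2$ whose projections on $X_1$ and $X_2$ are onto $X_1$ and $X_2$ respectively, such that $$\lim_{r_1\downarrow0}\frac{H([x_1,r_1],[x_2,1])-H(\mathfrak o_1,[x_2,1])}{r_1}=-\infty\quad\text{for every }(x_1,x_2)\in\Omega_H,$$ $$\lim_{r_2\downarrow0}\frac{H([x_1,1],[x_2,r_2])-H([x_1,1],\mathfrak o_2)}{r_2}=-\infty\quad\text{for every }(x_1,x_2)\in\Omega_H.$$ Let $\mu_i\in\mathcal M_+(X_i)$ be such that $\operatorname{supp}\mu_i=X_i$, $i=1,2$. Then there exists $(\varphi_1,\varphi_2)\in\Phi_H$ such that $$\int_{X_1}\varphi_1\,d\mu_1+\int_{X_2}\varphi_2\,d\mu_2=\mathcal U_H(\mu_1,\mu_2).$$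
   Context: $\mathcal M_+(X)$ is the set of finite nonnegative Radon measures on $X$. Cone: $\mathfrak C[X]=(X\times[0,+\infty))/\sim$, where $(x,r)\sim(y,s)$ iff ($x=y$ and $r=s\neq0$) or $r=s=0$; $[x,r]$ is the class of $(x,r)$ and $\mathfrak o=[x,0]$ the vertex ($\mathfrak o_i$ is the vertex of $\mathfrak C[X_i]$). A neighbourhood base at $[x,r]$ with $r>0$ is given by the images of the neighbourhoods of $(x,r)$ in the product topology; at $\mathfrak o$ by the sets $\{[x,r]:0\le r<\varepsilon\}$, $\varepsilon>0$. Products of cones have the product topology. $H$ is radially $1$-homogeneous if $H([x_1,\lambda r_1],[x_2,\lambda r_2])=\lambda H([x_1,r_1],[x_2,r_2])$ for all $\lambda>0$; radially convex if $(r_1,r_2)\mapsto H([x_1,r_1],[x_2,r_2])$ is convex on $[0,+\infty)^2$ for all $(x_1,x_2)$. $\Phi_H$ is the set of $(\varphi_1,\varphi_2)\in C_b(X_1)\times C_b(X_2)$ with $\varphi_1(x_1)r_1+\varphi_2(x_2)r_2\le H([x_1,r_1],[x_2,r_2])$ for all $x_i\in X_i$, $r_i\ge0$. $\mathcal U_H(\mu_1,\mu_2):=\inf\{\int H\,d\alpha:\alpha\in\mathfrak H^1(\mu_1,\mu_2)\}$, where $\mathfrak H^1(\mu_1,\mu_2)$ is the set of nonnegative finite Radon measures $\alpha$ on $\mathfrak C[X_1]\times\mathfrak C[X_2]$ with $\int(r_1+r_2)\,d\alpha<+\infty$ and $\mu_i(A)=\int_{\{r_i>0,\ x_i\in A\}}r_i\,d\alpha([x_1,r_1],[x_2,r_2])$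 for every Borel $A\subset X_i$, $i=1,2$. *)

(* Defs.v *)
From HB Require Import structures.
From mathcomp Require Import all_boot all_order all_algebra generic_quotient.
From mathcomp Require Import all_classical all_reals all_analysis.

Set Implicit Arguments.
Unset Strict Implicit.
Unset Printing Implicit Defensive.

Import Order.TTheory GRing.Theory Num.Theory numFieldNormedType.Exports.

Local Open Scope classical_set_scope.
Local Open Scope ring_scope.

Definition metrizable (R : realType) (X : topologicalType) : Prop :=
  exists d : X -> X -> R,
    [/\ forall x, d x x = 0,
        forall x y, d x y = 0 -> x = y,
        forall x y, d x y = d y x,
        forall x y z, d x z <= d x y + d y z &
        forall x : X, nbhs x =
          filter_from [set e : R | 0 < e] (fun e => [set y | d x y < e])].

Definition halfline (R : realType) : Type := [set r : R | 0 <= r].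
HB.instance Definition _ (R : realType) := Topological.on (halfline R).

Definition halfline_of (R : realType) (r : R) (r0 : 0 <= r) : halfline R :=
  exist _ r (mem_set r0).

Lemma max0_ge0 (R : realType) (r : R) : 0 <= Num.max 0 r.
Proof. by rewrite le_max lexx. Qed.

Section cone.
Variables (R : realType) (X : ptopologicalType).
Local Open Scope quotient_scope.

Definition cone_equiv (p q : X * halfline R) : bool :=
  [&& p.1 == q.1, p.2 == q.2 & \val p.2 != 0] ||
  (\val p.2 == 0) && (\val q.2 == 0).

Lemma cone_equiv_refl : reflexive cone_equiv.
Proof. by move=> p; rewrite /cone_equiv !eqxx /= andbb orNb. Qed.

Lemma cone_equiv_sym : symmetric cone_equiv.
Proof.
move=> [x r] [y s]; rewrite /cone_equiv /= (eq_sym y) (eq_sym s).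
rewrite [X in _ || X = _]andbC.
by case: (r =P s) => [->|]; rewrite ?andbF.
Qed.

Lemma cone_equiv_trans : transitive cone_equiv.
Proof.
move=> [y s] [x r] [z t]; rewrite /cone_equiv /=.
case/orP => [/and3P[/eqP -> /eqP -> s0] //|/andP[/eqP r0 /eqP ->]].
by rewrite r0 eqxx !andbF /= => ->.
Qed.

Canonical cone_equiv_equiv :=
  EquivRel cone_equiv cone_equiv_refl cone_equiv_sym cone_equiv_trans.

Definition cone : Type := {eq_quot cone_equiv}.

HB.instance Definition _ := Choice.on cone.
HB.instance Definition _ := Quotient.on cone.
HB.instance Definition _ := EqQuotient.on cone.

(* [cone_pt x r] is [x, r] for [0 <= r]; a negative [r] is truncated to 0. *)
Definition cone_pt (x : X) (r : R) : cone :=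
  \pi_cone (x, halfline_of (max0_ge0 r)).

Definition radius (p : cone) : R := \val (repr p).2.

(* The base point of [x, r] is [x] when [0 < r]; it is arbitrary at the
   vertex. *)
Definition base (p : cone) : X := (repr p).1.

Definition vertex : cone := cone_pt point 0.

HB.instance Definition _ := isPointed.Build cone vertex.

Lemma radius_ge0 p : 0 <= radius p.
Proof. by rewrite /radius; case: (repr p).2 => r /= /set_mem. Qed.

Lemma repr_pi (x : X) (r : halfline R) :
  \val r != 0 -> repr (\pi_cone (x, r)) = (x, r).
Proof.
move=> r0.
have /eqmodP : (x, r) = repr (\pi_cone (x, r)) %[mod {eq_quot cone_equiv}].
  by rewrite reprK.
rewrite /= /cone_equiv /= (negbTE r0) andbT orbF.
by case: (repr _) => y s /= /andP[/eqP <- /eqP <-].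
Qed.

Lemma radius_pi (x : X) (r : halfline R) : radius (\pi_cone (x, r)) = \val r.
Proof.
rewrite /radius; have [r0|r0] := eqVneq (\val r) 0; last by rewrite repr_pi.
have /eqmodP : (x, r) = repr (\pi_cone (x, r)) %[mod {eq_quot cone_equiv}].
  by rewrite reprK.
by rewrite /= /cone_equiv r0 /= r0 eqxx !andbF /= => /eqP.
Qed.

Lemma radius_cone_pt x r : 0 <= r -> radius (cone_pt x r) = r.
Proof. by move=> r0; rewrite radius_pi /= max_r. Qed.

Lemma base_cone_pt x r : 0 < r -> base (cone_pt x r) = x.
Proof. by move=> r0; rewrite /base repr_pi //= max_r ?gt_eqF // ltW. Qed.

Lemma cone_ptK p : cone_pt (base p) (radius p) = p.
Proof.
rewrite -[RHS]reprK /cone_pt; congr (\pi_cone _).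
rewrite [RHS]surjective_pairing; congr pair.
by apply: val_inj; rewrite /= max_r // radius_ge0.
Qed.

Lemma cone_pt0 x : cone_pt x 0 = vertex.
Proof.
apply/(eqmodP cone_equiv_equiv).
by apply/orP; right; rewrite /= maxxx eqxx.
Qed.

(* At [x, r] with [0 < r], the images of the neighbourhoods of [(x, r)] form a
   base; the filter they generate is the image filter by the projection. *)
Definition cone_nbhs (p : cone) : set_system cone :=
  if 0 < radius p then \pi_cone @ nbhs (repr p)
  else filter_from [set e : R | 0 < e] (fun e => [set q | radius q < e]).

HB.instance Definition _ := hasNbhs.Build cone cone_nbhs.

Let cone_nbhs_filter (p : cone) : ProperFilter (nbhs p).
Proof.
rewrite /nbhs /= /cone_nbhs; case: ifPn => p0; first exact: fmap_proper_filter.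
apply: filter_from_proper.
  apply: filter_from_filter; first by exists 1 => /=.
  move=> e f /= e0 f0; exists (Num.min e f); first by rewrite /= lt_min e0.
  by move=> q /=; rewrite lt_min => /andP.
by move=> e /= e0; exists vertex; rewrite /= radius_cone_pt.
Qed.

Let cone_nbhs_singleton (p : cone) (A : set cone) : nbhs p A -> A p.
Proof.
rewrite {1}/nbhs /= /cone_nbhs; case: ifPn => p0.
  by move=> /nbhs_singleton /=; rewrite reprK.
by case=> e /= e0; apply => /=; rewrite (le_lt_trans _ e0) // leNgt.
Qed.

Let cone_nbhs_pi (x : X) (r : halfline R) (A : set cone) : 0 < \val r ->
  nbhs (\pi_cone (x, r)) A = nbhs (x, r) (\pi_cone @^-1` A).
Proof.
by move=> r0; rewrite {1}/nbhs /= /cone_nbhs radius_pi r0 repr_pi ?gt_eqF.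
Qed.

Let val_snd_continuous : continuous (fun p : X * halfline R => \val p.2).
Proof.
move=> p; apply: (@continuous_comp _ _ _ snd (fun r : halfline R => \val r)).
  exact: cvg_snd.
exact: (@initial_continuous (halfline R) R \val).
Qed.

Let cone_nbhs_nbhs (p : cone) (A : set cone) :
  nbhs p A -> nbhs p (nbhs^~ A).
Proof.
rewrite {1 2}/nbhs /= /cone_nbhs; case: ifPn => p0.
  move=> /= pA; rewrite nbhs_simpl /=.
  have p0' : nbhs (repr p) [set q : X * halfline R | 0 < \val q.2].
    exact: (@val_snd_continuous (repr p) _ (lt_nbhsr p0)).
  apply: filterS (filterI p0' (nbhs_interior pA)) => -[x r] [r0 Axr] /=.
  by rewrite cone_nbhs_pi.
case=> e /= e0 eA; exists e => // q /= qe.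
rewrite -[q]reprK; case E : (repr q) => [x r].
have rE : radius q = \val r by rewrite /radius E.
have [r0|r0] := ltP 0 (\val r).
  rewrite cone_nbhs_pi //.
  have : nbhs (x, r) [set q : X * halfline R | \val q.2 < e].
    by rewrite rE in qe; exact: (@val_snd_continuous (x, r) _ (lt_nbhsl qe)).
  by apply: filterS => -[y s] /= se; apply: eA => /=; rewrite radius_pi.
rewrite /nbhs /= /cone_nbhs radius_pi ltNge r0 /=.
by exists e.
Qed.

HB.instance Definition _ := Nbhs_isNbhsTopological.Build cone
  cone_nbhs_filter cone_nbhs_singleton cone_nbhs_nbhs.

End cone.

(* Joins the existing product topology with the existing product point, so
   that a product can be a [ptopologicalType]. *)
HB.instance Definition _ (X Y : ptopologicalType) := Pointed.on (X * Y)%type.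

Arguments cone_pt R {X} x r.
Arguments vertex R X : clear implicits.

Definition borel (T : ptopologicalType) := g_sigma_algebraType (@open T).

(* Inner regularity by compact sets, in the form it takes for finite
   measures. *)
Definition radon (R : realType) (T : ptopologicalType)
    (mu : set (borel T) -> \bar R) : Prop :=
  forall A : set (borel T), measurable A -> forall e : R, 0 < e ->
  exists K : set T, [/\ compact K, K `<=` A & (mu (A `\` K) < e%:E)%E].

Definition supp (R : realType) (T : ptopologicalType)
    (mu : set (borel T) -> \bar R) : set T :=
  [set x | forall U : set T, open U -> U x -> (0 < mu U)%E].

Definition Cb (R : realType) (T : topologicalType) : set (T -> R) :=
  [set f | continuous f /\ bounded_fun f].

Section cost.
Variables (R : realType) (X1 X2 : ptopologicalType).
Local Notation C1 := (cone R X1).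
Local Notation C2 := (cone R X2).
Local Notation plan :=
  {finite_measure set (borel (C1 * C2)%type) -> \bar R}.
Implicit Types (H : C1 * C2 -> R) (alpha : plan).

Definition radially_homogeneous H : Prop :=
  forall (x1 : X1) (x2 : X2) (r1 r2 l : R), 0 <= r1 -> 0 <= r2 -> 0 < l ->
  H (cone_pt R x1 (l * r1), cone_pt R x2 (l * r2)) =
  l * H (cone_pt R x1 r1, cone_pt R x2 r2).

Definition radially_convex H : Prop := forall (x1 : X1) (x2 : X2),
  @convex_function R (R^o * R^o)%type
    [set r : (R^o * R^o)%type | 0 <= r.1 /\ 0 <= r.2]
    (fun r : (R^o * R^o)%type => H (cone_pt R x1 r.1, cone_pt R x2 r.2)).

Definition Phi H : set ((X1 -> R) * (X2 -> R)) :=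
  [set phi | [/\ Cb phi.1, Cb phi.2 &
    forall (x1 : X1) (x2 : X2) (r1 r2 : R), 0 <= r1 -> 0 <= r2 ->
      phi.1 x1 * r1 + phi.2 x2 * r2 <= H (cone_pt R x1 r1, cone_pt R x2 r2)]].

Local Open Scope ereal_scope.

Definition marginal1 (alpha : set (borel (C1 * C2)%type) -> \bar R)
    (A : set X1) : \bar R :=
  \int[alpha]_(p in [set p : C1 * C2 | (0 < radius p.1)%R /\ A (base p.1)])
    (radius p.1)%:E.

Definition marginal2 (alpha : set (borel (C1 * C2)%type) -> \bar R)
    (A : set X2) : \bar R :=
  \int[alpha]_(p in [set p : C1 * C2 | (0 < radius p.2)%R /\ A (base p.2)])
    (radius p.2)%:E.

Definition homogeneous_plans (mu1 : set (borel X1) -> \bar R)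
    (mu2 : set (borel X2) -> \bar R) : set plan :=
  [set alpha | [/\ radon alpha,
    \int[alpha]_(p in [set: C1 * C2]) (radius p.1 + radius p.2)%:E < +oo,
    forall A : set (borel X1), measurable A -> mu1 A = marginal1 alpha A &
    forall A : set (borel X2), measurable A -> mu2 A = marginal2 alpha A]].

Definition UH H (mu1 : set (borel X1) -> \bar R)
    (mu2 : set (borel X2) -> \bar R) : \bar R :=
  ereal_inf [set \int[alpha]_p (H p)%:E | alpha in homogeneous_plans mu1 mu2].

End cost.

(* Main.v *)
Require Import Defs.
From HB Require Import structures.
From mathcomp Require Import all_boot all_order all_algebra.
From mathcomp Require Import all_classical all_reals all_analysis.
From mathcomp Require Import measurable_realfun ring lra.

(** Write h(x, y, a, b) for H([x, a], [y, b]).  Homogeneity and radial convexity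
    make h(x, y, ., .) sublinear on the quadrant.

    Integrating the constraint of Phi_H against a homogeneous plan gives
    int phi1 dmu1 + int phi2 dmu2 <= U_H ([weak_duality]), so it is enough to
    find a feasible pair for which the sum of the integrals is at least U_H.
    Since U_H is an infimum, only nearly optimal plans are needed, and these
    can be written down: no representation or compactness theorem for measures
    enters.  Cut X1 and X2, up to null sets, into finitely many cells of
    positive mass on which h oscillates by at most d (a + b)
    ([finite_positive_partition], [small_oscillation_nbhs]).  Freezing h at one
    point of each cell leaves a finite problem over matrices with prescribed
    row and column sums.  The value of that problem is sublinear in the
    prescribed sums, so a finite-dimensional Hahn-Banach argument gives
    multipliers (u, v) without duality gap ([finite_duality]).  The matrices,
    spread over products of cells, are the push-forward of mu1 x mu2 by a
    piecewise continuous map, which is a genuine Radon plan ([discrete_plan]);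
    the multipliers, lowered by a multiple of d, are step functions satisfying
    the constraint almost everywhere, and the two values differ by O(d)
    ([near_optimal_steps]).

    It remains to replace the step functions by continuous functions from a
    compact family, and this is where the slopes and the supports are used.
    Fix y, choose x0 with (x0, y) in Omega_H and suppose that t, the value of
    the second function at y, comes within d of h(., y, 0, 1).  The constraint
    with radii (s, 1) then reads
    psi1(x) <= (h(x, y, s, 1) - h(x, y, 0, 1)) / s + d / s,
    which for small s and then smaller d is as negative as desired on half of
    the slice of Omega_H at y, an open set of positive mass; this contradicts the
    lower bound on int psi1 dmu1.  So there is a uniform gap ([uniform_gap]).  With
    such a gap, the infimum over (y, s) of h(x, y, 1, s) - psi2(y) s that
    defines the conjugate of psi2 is reached with s in a fixed bounded range:
    the conjugate is bounded and has a modulus of continuity that depends on h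
    and on the gap alone ([conjugate_bounds]).  Conjugating twice increases
    both integrals and yields feasible pairs, uniformly bounded and
    equicontinuous, whose values tend to U_H ([near_optimal_potentials]).
    Their pointwise limit along an ultrafilter is a uniform limit
    ([equicontinuous_ultralimit]) and solves the problem. *)

Set Implicit Arguments.
Unset Strict Implicit.
Unset Printing Implicit Defensive.

Import Order.TTheory GRing.Theory Num.Theory numFieldNormedType.Exports.

Local Open Scope classical_set_scope.
Local Open Scope ring_scope.

(** * Duality for finitely many cells *)

Section finite_hahn_banach.
Variables (R : realType) (T : finType).
Implicit Types (p q : (T -> R) -> R) (z e : T -> R).

Definition sublinear p :=
  (forall y z, p (y + z) <= p y + p z) /\
  (forall l z, 0 < l -> p (l *: z) = l * p z).

(** A sublinear function that is flat along every vector of a basis is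
    linear. *)
Definition flat_along p e := p (- e) = - p e.

Lemma sublinear0 p : sublinear p -> p 0 = 0.
Proof.
move=> [_ hom]; have := hom 2 0 (ltr0Sn _ _); rewrite scaler0 => E; lra.
Qed.

Lemma sublinearZ p l z : sublinear p -> 0 <= l -> p (l *: z) = l * p z.
Proof.
move=> sp; rewrite le_eqVlt => /predU1P[<-|l0]; last exact: sp.2.
by rewrite scale0r mul0r sublinear0.
Qed.

Lemma sublinearN p z : sublinear p -> - p (- z) <= p z.
Proof.
move=> sp; have := sp.1 z (- z); rewrite subrr sublinear0 // => ?; lra.
Qed.

(** The minorant is z |-> inf over s >= 0 of p (z + s e) - s p e.  Taking s = 1
    at z = - e shows that its value there is at most - p e, which forces
    flatness; sublinearity survives because the admissible s form a cone. *)
Lemma flatten_along p e : sublinear p ->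
  exists q, [/\ sublinear q, forall z, q z <= p z & flat_along q e].
Proof.
move=> sp; pose S z := [set p (z + s *: e) - s * p e | s in [set s : R | 0 <= s]].
have Sm z s : 0 <= s -> S z (p (z + s *: e) - s * p e) by move=> s0; exists s.
have lbS z r : S z r -> - p (- z) <= r.
  case=> s /= s0 <-; have := sp.1 (z + s *: e) (- z).
  rewrite addrAC subrr add0r sublinearZ // => ?; lra.
have hS z : has_inf (S z).
  by split; [exists (p (z + 0 *: e) - 0 * p e); exact: Sm|exists (- p (- z)); move=> r /lbS].
have qle z s : 0 <= s -> inf (S z) <= p (z + s *: e) - s * p e.
  by move=> s0; apply: ge_inf; [exact: (hS z).2|exact: Sm].
have sq : sublinear (fun z => inf (S z)).
  split.
    move=> y z; rewrite -lerBlDr; apply: lb_le_inf; first exact: (hS y).1.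
    move=> _ [s /= s0 <-]; rewrite lerBlDr -lerBlDl.
    apply: lb_le_inf; first exact: (hS z).1.
    move=> _ [t /= t0 <-]; rewrite lerBlDl.
    apply: le_trans (qle (y + z) (s + t) (addr_ge0 s0 t0)) _.
    have -> : y + z + (s + t) *: e = (y + s *: e) + (z + t *: e).
      by rewrite scalerDl addrACA.
    have := sp.1 (y + s *: e) (z + t *: e); lra.
  have half l z : 0 < l -> inf (S (l *: z)) <= l * inf (S z).
    move=> l0; rewrite -ler_pdivrMl //; apply: lb_le_inf; first exact: (hS z).1.
    move=> _ [s /= s0 <-]; rewrite ler_pdivrMl //.
    apply: le_trans (qle _ (l * s) (mulr_ge0 (ltW l0) s0)) _.
    by rewrite -scalerA -scalerDr sp.2 // -mulrA -mulrBr.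
  move=> l z l0; apply/eqP; rewrite eq_le half //=.
  have := half l^-1 (l *: z); rewrite invr_gt0 => /(_ l0).
  by rewrite scalerA mulVf ?gt_eqF // scale1r -ler_pdivlMl.
exists (fun z => inf (S z)); split=> //.
  by move=> z; have := qle z 0 (lexx _); rewrite scale0r addr0 mul0r subr0.
apply/eqP; rewrite eq_le; apply/andP; split; last first.
  by rewrite lerNl; exact: (sublinearN e sq).
have := qle (- e) 1 ler01; rewrite scale1r addNr sublinear0 // mul1r sub0r => h.
apply: (le_trans h); rewrite lerN2.
by have := qle e 0 (lexx _); rewrite scale0r addr0 mul0r subr0.
Qed.

(** Flatten along the basis vectors one after the other.  Passing to a smaller
    sublinear function keeps the flatness already obtained, so the last
    function is linear. *)
Lemma finite_hahn_banach p : sublinear p ->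
  exists u : T -> R, forall z, \sum_t u t * z t <= p z.
Proof.
move=> sp; pose d (t : T) : T -> R := fun t' => (t' == t)%:R.
have [q [sq qp fq]] : exists q, [/\ sublinear q, forall z, q z <= p z &
    forall t, t \in enum T -> flat_along q (d t)].
  elim: (enum T) => [|t s [q [sq qp fq]]]; first by exists p.
  have [q' [sq' q'q fq']] := flatten_along (d t) sq.
  exists q'; split=> // [z|t']; first exact: le_trans (qp z).
  rewrite inE => /predU1P[->//|/fq fqt]; rewrite /flat_along.
  have := sublinearN (d t') sq'; have := q'q (- d t'); have := q'q (d t').
  rewrite fqt => *; apply/eqP; rewrite eq_le; apply/andP; split; lra.
exists (fun t => q (d t)) => z; apply: le_trans (qp z).
apply: le_trans (sublinearN z sq); rewrite lerNr -sumrN.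
have -> : - z = \sum_t (- z t) *: d t.
  apply/funext => t; rewrite fct_sumE (bigD1 t) //= big1 ?addr0.
    by rewrite /GRing.scale /= /d eqxx [RHS]mulr1.
  by move=> t' /negbTE nt; rewrite /GRing.scale /= /d eq_sym nt; exact: mulr0.
have le_sum (s : seq T) (F : T -> T -> R) : q (\sum_(t <- s) F t) <= \sum_(t <- s) q (F t).
  elim: s => [|t s IH]; first by rewrite !big_nil sublinear0.
  by rewrite !big_cons (le_trans (sq.1 _ _)) // lerD2l.
apply: (le_trans (le_sum _ _)); apply: ler_sum => t _.
have [zt|zt] := leP 0 (- z t).
  by rewrite sublinearZ // mulNr mulrC.
have -> : - z t *: d t = z t *: (- d t) by rewrite scalerN scaleNr.
rewrite sublinearZ //; last by rewrite -oppr_le0 ltW.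
by rewrite fq ?mem_enum // mulrN mulrC.
Qed.

End finite_hahn_banach.

Section finite_duality.
Variables (R : realType) (I J : finType) (i0 : I) (j0 : J).
Variable h : I -> J -> R -> R -> R.
Hypothesis h_ge0 : forall i j a b, 0 <= a -> 0 <= b -> 0 <= h i j a b.
Hypothesis h_sub : forall i j a b a' b', 0 <= a -> 0 <= b -> 0 <= a' -> 0 <= b' ->
  h i j (a + a') (b + b') <= h i j a b + h i j a' b'.
Hypothesis h_hom : forall i j a b l, 0 <= a -> 0 <= b -> 0 < l ->
  h i j (l * a) (l * b) = l * h i j a b.
Implicit Types (a b : I -> J -> R) (z w : I + J -> R).

Definition couples a b z :=
  [/\ forall i j, 0 <= a i j, forall i j, 0 <= b i j,
      forall i, \sum_j a i j = z (inl i) & forall j, \sum_i b i j = z (inr j)].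

Definition total_cost a b := \sum_i \sum_j h i j (a i j) (b i j).

Let total_cost_ge0 a b z : couples a b z -> 0 <= total_cost a b.
Proof.
by case=> a0 b0 _ _; apply: sumr_ge0 => i _; apply: sumr_ge0 => j _; exact: h_ge0.
Qed.

Let couplesD a b z a' b' z' : couples a b z -> couples a' b' z' ->
  couples (fun i j => a i j + a' i j) (fun i j => b i j + b' i j) (z + z').
Proof.
move=> [a0 b0 ar br] [a0' b0' ar' br']; split=> [i j|i j|i|j].
- exact: addr_ge0.
- exact: addr_ge0.
- by rewrite big_split /= ar ar'.
- by rewrite big_split /= br br'.
Qed.

Let total_costD a b z a' b' z' : couples a b z -> couples a' b' z' ->
  total_cost (fun i j => a i j + a' i j) (fun i j => b i j + b' i j) <=
  total_cost a b + total_cost a' b'.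
Proof.
move=> [a0 b0 _ _] [a0' b0' _ _]; rewrite -big_split; apply: ler_sum => i _.
by rewrite -big_split; apply: ler_sum => j _; exact: h_sub.
Qed.

Let couplesZ a b z l : 0 <= l -> couples a b z ->
  couples (fun i j => l * a i j) (fun i j => l * b i j) (l *: z).
Proof.
move=> l0 [a0 b0 ar br]; split=> [i j|i j|i|j].
- exact: mulr_ge0.
- exact: mulr_ge0.
- by rewrite -mulr_sumr ar.
- by rewrite -mulr_sumr br.
Qed.

Let total_costZ a b z l : 0 < l -> couples a b z ->
  total_cost (fun i j => l * a i j) (fun i j => l * b i j) = l * total_cost a b.
Proof.
move=> l0 [a0 b0 _ _]; rewrite mulr_sumr; apply: eq_bigr => i _.
by rewrite mulr_sumr; apply: eq_bigr => j _; exact: h_hom.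
Qed.

Let sum_delta (K : finType) (k0 : K) (c : R) : \sum_k (if k == k0 then c else 0) = c.
Proof. by rewrite -big_mkcond /= big_pred1_eq. Qed.

Let couples_ex z : (forall k, 0 <= z k) -> exists a b, couples a b z.
Proof.
move=> z0; exists (fun i j => if j == j0 then z (inl i) else 0).
exists (fun i j => if i == i0 then z (inr j) else 0).
by split=> [i j|i j|i|j]; [case: ifP|case: ifP|exact: sum_delta|exact: sum_delta].
Qed.

(** The optimal cost is sublinear in the prescribed sums z, but it is finite on
    the orthant only.  With V the optimal cost at w, the function
    p z = inf over t >= 0 of (cost of coupling z + t w) - t V is finite
    everywhere because w is interior to the orthant, it lies below the optimal
    cost (t = 0) and p (- w) <= - V (t = 1, zero matrices).  A linear minorant
    of p is then a pair of multipliers of value at least V. *)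
Lemma finite_duality w (e : R) : (forall k, 0 < w k) -> 0 < e ->
  exists a b u v, [/\ couples a b w,
    forall i j s t, 0 <= s -> 0 <= t -> u i * s + v j * t <= h i j s t &
    total_cost a b <= \sum_i u i * w (inl i) + \sum_j v j * w (inr j) + e].
Proof.
move=> w0 e0.
pose S z := [set r | exists a b, couples a b z /\ r = total_cost a b].
have Slb z : lbound (S z) 0 by move=> _ [a [b [ab ->]]]; exact: total_cost_ge0 ab.
have Sn z : (forall k, 0 <= z k) -> S z !=set0.
  by move=> /couples_ex[a [b ab]]; exists (total_cost a b), a, b.
pose V := inf (S w).
have hSw : has_inf (S w) by split; [exact: Sn (fun k => ltW (w0 k))|exists 0].
have Vle l a b : 0 <= l -> couples a b (l *: w) -> l * V <= total_cost a b.
  rewrite le_eqVlt => /predU1P[<- /total_cost_ge0|l0 ab]; first by rewrite mul0r.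
  rewrite -ler_pdivlMl // -(total_costZ _ ab) ?invr_gt0 //.
  apply: ge_inf; first by exists 0.
  eexists; eexists; split; last by [].
  have := couplesZ (ltW (_ : 0 < l^-1)) ab; rewrite invr_gt0 scalerA mulVf ?gt_eqF // scale1r.
  by apply.
(* the function p of the comment above is the infimum of P *)
pose P z := [set r | exists t a b,
  [/\ 0 <= t, couples a b (z + t *: w) & r = total_cost a b - t * V]].
have big z : exists2 s, 0 <= s & forall k, 0 <= (s *: w + z) k.
  exists (\sum_k `|z k| / w k) => [|k].
    by apply: sumr_ge0 => k _; rewrite divr_ge0 // ltW.
  rewrite -[X in _ <= X]/((\sum_k `|z k| / w k) * w k + z k) (bigD1 k) //= mulrDl.
  rewrite divfK ?gt_eqF // addrAC addr_ge0 //; last first.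
    apply: mulr_ge0 (ltW (w0 k)); apply: sumr_ge0 => k' _.
    by rewrite divr_ge0 // ltW.
  by have := ler_norm (- z k); rewrite normrN; lra.
  have hP z : has_inf (P z).
  split.
    have [s s0 /Sn[_ [a [b [ab _]]]]] := big z.
    by exists (total_cost a b - s * V), s, a, b; split=> //; rewrite addrC.
  (* lower bound: adding a coupling of s w - z gives one of (t + s) w *)
  have [s s0 /Sn[_ [a [b [ab _]]]]] := big (- z).
  exists (- total_cost a b + s * V) => _ [t [a' [b' [t0 ab' ->]]]].
  have := Vle (t + s) _ _ (addr_ge0 t0 s0) _; have := total_costD ab' ab.
  have := couplesD ab' ab; have -> : z + t *: w + (s *: w - z) = (t + s) *: w.
    by rewrite [s *: w - z]addrC addrACA subrr add0r scalerDl.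
  move=> c1 c2 /(_ _ _ c1); lra.
pose p z := inf (P z).
have ple z t a b : 0 <= t -> couples a b (z + t *: w) -> p z <= total_cost a b - t * V.
  by move=> t0 ab; apply: ge_inf; [exact: (hP z).2|exists t, a, b].
have sp : sublinear p.
  split.
    move=> y z; rewrite -lerBlDr; apply: lb_le_inf; first exact: (hP y).1.
    move=> _ [s [a [b [s0 ab ->]]]]; rewrite lerBlDr -lerBlDl.
    apply: lb_le_inf; first exact: (hP z).1.
    move=> _ [t [a' [b' [t0 ab' ->]]]]; rewrite lerBlDl.
    have := couplesD ab ab'; rewrite addrACA -scalerDl => c.
    apply: le_trans (ple _ _ _ _ (addr_ge0 s0 t0) c) _.
    have := total_costD ab ab'; lra.
  have half l z : 0 < l -> p (l *: z) <= l * p z.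
    move=> l0; rewrite -ler_pdivrMl //; apply: lb_le_inf; first exact: (hP z).1.
    move=> _ [s [a [b [s0 ab ->]]]]; rewrite ler_pdivrMl //.
    have := couplesZ (ltW l0) ab; rewrite scalerDr scalerA => c.
    apply: le_trans (ple _ _ _ _ (mulr_ge0 (ltW l0) s0) c) _.
    by rewrite (total_costZ l0 ab) -mulrA -mulrBr.
  move=> l z l0; apply/eqP; rewrite eq_le half //=.
  have := half l^-1 (l *: z); rewrite invr_gt0 => /(_ l0).
  by rewrite scalerA mulVf ?gt_eqF // scale1r -ler_pdivlMl.
have [u up] := finite_hahn_banach sp.
have [_ [a [b [ab ->]]] abV] := inf_adherent e0 hSw.
exists a, b, (fun i => u (inl i)), (fun j => u (inr j)); split=> //.
- move=> i j s t s0 t0.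
  pose z : I + J -> R := fun k => match k with inl i' => if i' == i then s else 0
     | inr j' => if j' == j then t else 0 end.
  pose as_ i' j' := if (i' == i) && (j' == j) then s else 0.
  pose bs_ i' j' := if (i' == i) && (j' == j) then t else 0.
  have cz : couples as_ bs_ z.
    rewrite /as_ /bs_; split=> [i' j'|i' j'|i'|j'] /=.
    + by case: ifP.
    + by case: ifP.
    + by case: (i' == i) => /=; rewrite ?sum_delta // big1.
    + case: (j' == j) => /=.
        by under eq_bigr do rewrite andbT; rewrite sum_delta.
      by rewrite big1 // => ? _; rewrite andbF.
  have h0 i' j' : h i' j' 0 0 = 0.
    have := h_hom i' j' (lexx 0) (lexx 0) (ltr0Sn R 1); rewrite mulr0; lra.
  have := le_trans (up z) (ple z 0 as_ bs_ (lexx _) _).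
  rewrite scale0r addr0 => /(_ cz); rewrite mul0r subr0 big_sumType /=.
  have -> : \sum_i0 u (inl i0) * (if i0 == i then s else 0) = u (inl i) * s.
    by rewrite (bigD1 i) //= eqxx big1 ?addr0 // => k /negbTE ->; rewrite mulr0.
  have -> : \sum_i0 u (inr i0) * (if i0 == j then t else 0) = u (inr j) * t.
    by rewrite (bigD1 j) //= eqxx big1 ?addr0 // => k /negbTE ->; rewrite mulr0.
  move=> /le_trans; apply; rewrite /total_cost (bigD1 i) //= (bigD1 j) //=.
  rewrite /as_ /bs_ !eqxx /= big1 ?addr0; last by move=> k /negbTE -> /=.
  by rewrite big1 ?addr0 // => k /negbTE -> /=; rewrite big1.
- have c0 : couples (fun _ _ => 0) (fun _ _ => 0) (- w + 1 *: w).
    by rewrite scale1r addNr; split=> // k; rewrite big1.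
  have := le_trans (up (- w)) (ple _ _ _ _ ler01 c0).
  have -> : total_cost (fun _ _ => 0) (fun _ _ => 0) = 0.
    have h0 i' j' : h i' j' 0 0 = 0.
      have := h_hom i' j' (lexx 0) (lexx 0) (ltr0Sn R 1); rewrite mulr0; lra.
    by rewrite /total_cost big1 // => k _; rewrite big1.
  rewrite (_ : \sum_t u t * (- w) t = - \sum_t u t * w t); last first.
    by rewrite -sumrN; apply: eq_bigr => k _; rewrite fctE mulrN.
  rewrite big_sumType /= mul1r sub0r lerN2 => Vu.
  by apply: (le_trans (ltW abV)); rewrite lerD2r.
Qed.

End finite_duality.

(** * Uniformity from compactness *)

Section continuity.
Implicit Types T U V : topologicalType.

Lemma fst_continuous U V : continuous (@fst U V).
Proof. by move=> q; exact: (@cvg_fst _ _ (nbhs q.1) (nbhs q.2) _). Qed.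

Lemma snd_continuous U V : continuous (@snd U V).
Proof. by move=> q; exact: (@cvg_snd _ _ (nbhs q.1) (nbhs q.2) _). Qed.

Lemma pair_continuous T U V (f : T -> U) (g : T -> V) :
  continuous f -> continuous g -> continuous (fun t => (f t, g t)).
Proof. by move=> cf cg t; exact: cvg_pair (cf t) (cg t). Qed.

Lemma continuous_comp_global T U V (f : T -> U) (g : U -> V) :
  continuous f -> continuous g -> continuous (g \o f).
Proof. by move=> cf cg t; exact: (continuous_comp (cf t) (cg (f t))). Qed.

End continuity.

Section compactness.
Variable R : realType.

Lemma compact_uniform_near (X Z : topologicalType) (K : set Z) (f : X * Z -> R)
    (x0 : X) (e : R) : compact K -> continuous f -> 0 < e ->
  \forall x \near x0, forall z, K z -> `|f (x, z) - f (x0, z)| < e.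
Proof.
move=> /compact_near_coveringP cK cf e0.
apply: (cK X (nbhs x0) (fun x z => `|f (x, z) - f (x0, z)| < e)) => z0 Kz0.
have e20 : 0 < e / 2 by rewrite divr_gt0.
have /cvgrPdist_lt /(_ _ e20) := cf (x0, z0).
case=> -[U V] /= [Ux0 Vz0] UV.
exists (V, U) => //= -[z x] /= [Vz Ux].
have h1 : `|f (x0, z0) - f (x, z)| < e / 2 by apply: (UV (x, z)).
have h2 : `|f (x0, z0) - f (x0, z)| < e / 2.
  by apply: (UV (x0, z)); split=> //=; exact: nbhs_singleton.
have := ler_distD (f (x0, z0)) (f (x, z)) (f (x0, z)).
rewrite (distrC (f (x, z)) (f (x0, z0))); lra.
Qed.

Lemma compact_norm_bound (Z : topologicalType) (K : set Z) (f : Z -> R) :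
  compact K -> continuous f -> exists2 C, 0 <= C & forall z, K z -> `|f z| <= C.
Proof.
move=> cK cf; have : bounded_set (f @` K).
  by apply: compact_bounded; apply: continuous_compact => //; exact: continuous_subspaceT.
case=> M [_ /(_ (`|M| + 1))]; rewrite (le_lt_trans (ler_norm M)) ?ltrDl // => /(_ isT) h.
by exists (`|M| + 1) => [|z Kz]; [exact: addr_ge0|apply: h; exists z].
Qed.

End compactness.

(** * Conjugate potentials *)

Section cost_conjugate.
Variables (R : realType) (X Y : topologicalType).
Hypotheses (cptX : compact [set: X]) (cptY : compact [set: Y]).
Variable h : X -> Y -> R -> R -> R.
Hypothesis h_cont :
  continuous (fun q : X * (Y * (R * R)) => h q.1 q.2.1 q.2.2.1 q.2.2.2).
Hypothesis h_ge0 : forall x y a b, 0 <= a -> 0 <= b -> 0 <= h x y a b.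
Hypothesis h_hom : forall x y a b l, 0 <= a -> 0 <= b -> 0 < l ->
  h x y (l * a) (l * b) = l * h x y a b.

Lemma cost_near (x0 : X) (r e : R) : 0 < e ->
  \forall x \near x0, forall y a b, 0 <= a <= r -> 0 <= b <= r ->
    `|h x y a b - h x0 y a b| < e.
Proof.
move=> e0; pose I := `[0, r]%classic : set R.
have cK : compact ([set: Y] `*` (I `*` I)).
  by apply: compact_setX => //; apply: compact_setX; exact: segment_compact.
have := compact_uniform_near x0 cK h_cont e0; apply: filterS => x hx y a b ar br.
by apply: (hx (y, (a, b))); split=> //; split; rewrite /I /= in_itv.
Qed.

Lemma cost_radius_near (e : R) : 0 < e ->
  \forall s \near 0^'+, forall x y, `|h x y s 1 - h x y 0 1| < e.
Proof.
move=> e0; pose f (q : R * (X * Y)) := h q.2.1 q.2.2 q.1 1.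
have cf : continuous f.
  pose g (q : R * (X * Y)) : X * (Y * (R * R)) := (q.2.1, (q.2.2, (q.1, 1))).
  have cg : continuous g.
    apply: (@pair_continuous _ _ _ (fun q => q.2.1)).
      exact: continuous_comp_global (@snd_continuous _ _) (@fst_continuous _ _).
    apply: (@pair_continuous _ _ _ (fun q => q.2.2)).
      exact: continuous_comp_global (@snd_continuous _ _) (@snd_continuous _ _).
    apply: (@pair_continuous _ _ _ (fun q => q.1)); first exact: fst_continuous.
    exact: cst_continuous.
  exact: (continuous_comp_global cg h_cont).
have cK : compact ([set: X] `*` [set: Y]) by exact: compact_setX.
have near0 := compact_uniform_near 0 cK cf e0.
apply: cvg_within; apply: filterS near0 => s hs x y; exact: (hs (x, y)).
Qed.

Lemma cost_bounded : exists2 C, 0 <= C &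
  forall x y a b, 0 <= a <= 1 -> 0 <= b <= 1 -> h x y a b <= C.
Proof.
pose I := `[0, 1]%classic : set R.
have cK : compact ([set: X] `*` ([set: Y] `*` (I `*` I))).
  apply: compact_setX => //; apply: compact_setX => //.
  by apply: compact_setX; exact: segment_compact.
have [C C0 hC] := compact_norm_bound cK h_cont.
exists C => // x y a b ar br; apply: le_trans (ler_norm _) _.
by apply: (hC (x, (y, (a, b)))); split=> //; split=> //; split; rewrite /I /= in_itv.
Qed.

(** By homogeneity the constraint t a + psi y b <= h x y a b is equivalent, for
    a > 0, to t <= h x y 1 s - psi y s with s = b / a. *)
Definition conjugate (E : set Y) (psi : Y -> R) (x : X) : R :=
  inf [set r | exists y s, [/\ E y, 0 <= s & r = h x y 1 s - psi y * s]].

(** For large s, h x y 1 s - psi y s = s (h x y (1 / s) 1 - psi y) >= s d / 2,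
    which exceeds the value h x y 1 0 at s = 0.  So only s in [0, r] matter,
    where r depends on h and d but not on E and psi; the bound M and the
    comparison between two points x and x' follow from this. *)
Lemma conjugate_bounds (d : R) : 0 < d -> exists r M : R,
  forall (E : set Y) (psi : Y -> R), E !=set0 ->
  (forall x y, E y -> psi y + d <= h x y 0 1) ->
  [/\ forall x y a b, E y -> 0 <= a -> 0 <= b ->
        conjugate E psi x * a + psi y * b <= h x y a b,
      forall x, `|conjugate E psi x| <= M,
      forall x t, (forall y a b, E y -> 0 <= a -> 0 <= b ->
        t * a + psi y * b <= h x y a b) -> t <= conjugate E psi x &
      forall x x' e, (forall y s, 0 <= s <= r -> `|h x y 1 s - h x' y 1 s| <= e) ->
        conjugate E psi x <= conjugate E psi x' + e].
Proof.
move=> d0; have [C C0 hC] := cost_bounded.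
have d20 : 0 < d / 2 by rewrite divr_gt0.
have [eta /= eta0 heta] := cost_radius_near d20.
(* beyond r, 1 / s is close enough to 0 and s d / 2 is at least C *)
pose r := Num.max (eta^-1 + 1) (C / (d / 2)).
have r0 : 0 < r by rewrite lt_max addr_gt0 // invr_gt0.
exists r, (C * r + C) => E psi [y0 Ey0] gap.
pose v x y s := h x y 1 s - psi y * s.
pose S x := [set r | exists y s, [/\ E y, 0 <= s & r = v x y s]].
have psiC (x : X) y : E y -> psi y <= C.
  by move=> Ey; have := gap x y Ey; have := hC x y 0 1; rewrite !lexx !ler01; lra.
have short x y s : E y -> 0 <= s -> exists2 s', 0 <= s' <= r & v x y s' <= v x y s.
  move=> Ey s0; have [sr|rs] := leP s r; first by exists s; rewrite ?s0.
  exists 0; first by rewrite lexx ltW.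
  have sp : 0 < s := lt_trans r0 rs.
  have [rs1 rs2] : eta^-1 + 1 < s /\ C / (d / 2) < s.
    by move: rs; rewrite gt_max => /andP.
  have close : `|h x y s^-1 1 - h x y 0 1| < d / 2.
    apply: heta; last by rewrite /= invr_gt0.
    rewrite /= sub0r normrN gtr0_norm ?invr_gt0 // invf_plt ?posrE //.
    by apply: lt_trans rs1; rewrite ltrDl.
  have hs : h x y 1 s = s * h x y s^-1 1.
    by rewrite -h_hom ?invr_ge0 // mulfV ?gt_eqF // mulr1.
  have h10 : h x y 1 0 <= C by apply: hC; rewrite ?lexx ?ler01.
  have Cs : C <= s * (d / 2) by rewrite -ler_pdivrMr // ltW.
  rewrite /v hs mulr0 subr0 (le_trans h10) // (le_trans Cs) //.
  rewrite [psi y * s]mulrC -mulrBr ler_pM2l //.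
  by have := gap x y Ey; move: close; rewrite ltr_norml => /andP[]; lra.
have vlb x y s : E y -> 0 <= s -> - (C * r) <= v x y s.
  move=> Ey s0; have [s' /andP[s'0 s'r] /(le_trans _)] := short x y s Ey s0; apply.
  have h0 : 0 <= h x y 1 s' by exact: h_ge0.
  have : psi y * s' <= C * r.
    apply: (@le_trans _ _ (C * s')); first by rewrite ler_wpM2r // (psiC x).
    by rewrite ler_wpM2l.
  rewrite /v; lra.
have hS x : has_inf (S x).
  split; first by exists (v x y0 0), y0, 0.
  by exists (- (C * r)) => _ [y [s [Ey s0 ->]]]; exact: vlb.
have cle x y s : E y -> 0 <= s -> conjugate E psi x <= v x y s.
  by move=> Ey s0; apply: ge_inf; [exact: (hS x).2|exists y, s].
have cge x t : (forall y s, E y -> 0 <= s -> t <= v x y s) -> t <= conjugate E psi x.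
  by move=> ht; apply: lb_le_inf; [exact: (hS x).1|move=> _ [y [s [Ey s0 ->]]]; exact: ht].
split.
- move=> x y a b Ey; rewrite le_eqVlt => /predU1P[<- b0|a0].
    rewrite mulr0 add0r; move: b0; rewrite le_eqVlt => /predU1P[<-|b0].
      by rewrite mulr0 h_ge0.
    have := h_hom x y (lexx 0) ler01 b0; rewrite mulr0 mulr1 => ->.
    by rewrite mulrC ler_pM2l //; have := gap x y Ey; lra.
  move=> b0; have ba0 : 0 <= b / a := divr_ge0 b0 (ltW a0).
  have := cle x y (b / a) Ey ba0; rewrite /v -(ler_pM2l a0) mulrBr -h_hom //.
  have ab : a * (b / a) = b by rewrite mulrC divfK // gt_eqF.
  by rewrite mulr1 (mulrCA a (psi y)) ab; lra.
- move=> x; rewrite ler_norml; apply/andP; split.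
    rewrite (@le_trans _ _ (- (C * r))) //; first by lra.
    by apply: cge => y s Ey s0; exact: vlb.
  have := cle x y0 0 Ey0 (lexx _); rewrite /v mulr0 subr0.
  have : h x y0 1 0 <= C by apply: hC; rewrite ?lexx ?ler01.
  have : 0 <= C * r by rewrite mulr_ge0 // ltW.
  lra.
- move=> x t ht; apply: cge => y s Ey s0.
  by have := ht y 1 s Ey ler01 s0; rewrite /v; lra.
- move=> x x' e hxx'; rewrite -lerBlDr; apply: cge => y s Ey s0.
  have [s' s'r] := short x' y s Ey s0; apply: le_trans.
  rewrite lerBlDr; apply: le_trans (cle x y s' Ey _) _; first by case/andP: s'r.
  have := hxx' y s' s'r; rewrite ler_norml => /andP[_]; rewrite /v; lra.
Qed.
End cost_conjugate.

(** * Functions and sets on Borel spaces *)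

Lemma borel_open (T : ptopologicalType) (A : set T) :
  open A -> measurable (A : set (borel T)).
Proof. exact: sub_sigma_algebra. Qed.

Lemma borel_closed (T : ptopologicalType) (A : set T) :
  closed A -> measurable (A : set (borel T)).
Proof.
move=> cA; rewrite -[A]setCK; apply: measurableC; apply: borel_open.
exact: closed_openC.
Qed.

Lemma continuous_borel_measurable (R : realType) (T : ptopologicalType) (f : T -> R) :
  continuous f -> measurable_fun setT (f : borel T -> R).
Proof.
move=> cf; apply: (measurability _ (RGenOInfty.measurableE R)) => _ [_ [x ->] <-].
rewrite setTI; apply: borel_open; apply: open_comp => // y _; exact: cf.
Qed.

Lemma bounded_integrable d (T : measurableType d) (R : realType)
    (mu : {finite_measure set T -> \bar R}) (f : T -> R) (M : R) :
  measurable_fun setT f -> (forall x, `|f x| <= M) -> mu.-integrable setT (EFin \o f).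
Proof.
move=> mf fM; apply: measurable_bounded_integrable => //; first exact: fin_num_fun_lty.
by exists M; split; rewrite ?num_real // => x Mx y _ /=; exact: le_trans (fM y) (ltW Mx).
Qed.

Lemma le_Rintegral_full d (T : measurableType d) (R : realType)
    (mu : {measure set T -> \bar R}) (E : set T) (f g : T -> R) :
  measurable E -> mu (~` E) = 0%E ->
  mu.-integrable setT (EFin \o f) -> mu.-integrable setT (EFin \o g) ->
  (forall x, E x -> f x <= g x) -> \int[mu]_x f x <= \int[mu]_x g x.
Proof.
move=> mE muE If Ig fg; have mCE : measurable (~` E) := measurableC mE.
rewrite /Rintegral (negligible_integral mCE measurableT If muE).
rewrite (negligible_integral mCE measurableT Ig muE).
rewrite !setTD setCK; apply: le_Rintegral => //; exact: integrableS If || exact: integrableS Ig.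
Qed.

(** The sets on which all q k with k >= n are below K increase to U, so one of
    them has at least half of the mass. *)
Lemma half_measure_below d (T : measurableType d) (R : realType)
    (mu : {finite_measure set T -> \bar R}) (U : set T) (q : nat -> T -> R) (K : R) :
  measurable U -> (0 < mu U)%E -> (forall n, measurable_fun setT (q n)) ->
  (forall x, U x -> q n x @[n --> \oo] --> -oo) ->
  exists n, fine (mu U) <= 2 * fine (mu (U `&` [set x | q n x < K])).
Proof.
move=> mU U0 mq qoo; pose B n := U `&` [set x | q n x < K].
have mB n : measurable (B n).
  apply: measurableI => //; have -> : [set x | q n x < K] = q n @^-1` `]-oo, K[.
    by apply/seteqP; split=> x /=; rewrite in_itv.
  by rewrite -[_ @^-1` _]setTI; apply: mq.
pose D N := \bigcap_(n in [set n | (N <= n)%N]) B n.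
have mD N : measurable (D N) by exact: bigcap_measurableType.
have DU : \bigcup_N D N = U.
  apply/seteqP; split=> [x [N _ /(_ N)] [] //=|x Ux].
  have /cvgrNyPlt /(_ K) [N _ hN] := qoo x Ux.
  by exists N => // n /= Nn; split=> //; exact: hN.
have ndD : nondecreasing_seq D.
  by move=> m n mn; apply/subsetPset => x Dx k /= nk; apply: Dx => /=; exact: leq_trans nk.
have := nondecreasing_cvg_mu mD (bigcup_measurable (fun n _ => mD n)) ndD.
move=> /(_ _ mu); rewrite DU => cD.
have [[n hn]|noN] := pselect (exists n, fine (mu U) <= 2 * fine (mu (B n))).
  by exists n.
have Ufin : mu U \is a fin_num by exact: fin_num_measure.
have U0' : 0 < fine (mu U) by rewrite fine_gt0 // U0 ltey_eq Ufin.
suff : (mu U <= (fine (mu U) / 2)%:E)%E by rewrite -[leLHS]fineK // lee_fin; lra.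
rewrite -[leLHS](cvg_lim _ cD) //; apply: lime_le; first by apply/cvg_ex; exists (mu U).
near=> n; apply: (@le_trans _ _ (mu (B n))).
  apply: le_measure; rewrite ?inE; [exact: mD|exact: mB|].
  by move=> x /(_ n) /=; exact.
have fB : mu (B n) \is a fin_num by exact: fin_num_measure.
have noB : ~ (fine (mu U) <= 2 * fine (mu (B n))) by move=> ?; apply: noN; exists n.
rewrite -[leLHS]fineK // lee_fin; move/negP: noB; rewrite -ltNge => /ltW nB.
by rewrite ler_pdivlMr // mulrC.
Unshelve. all: by end_near. Qed.

(** * The gap produced by infinite slopes *)

Section uniform_gap.
Variables (R : realType) (X Y : ptopologicalType).
Hypotheses (cptX : compact [set: X]) (cptY : compact [set: Y]).
Variable h : X -> Y -> R -> R -> R.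
Hypothesis h_cont :
  continuous (fun q : X * (Y * (R * R)) => h q.1 q.2.1 q.2.2.1 q.2.2.2).
Hypothesis h_vertex : forall x x' y b, h x y 0 b = h x' y 0 b.
Hypothesis h_slope : exists Omega : set (X * Y),
  [/\ open Omega, snd @` Omega = [set: Y] & forall x y, Omega (x, y) ->
      (h x y r 1 - h x y 0 1) / r @[r --> 0^'+] --> -oo].
Variable mu : {finite_measure set (borel X) -> \bar R}.
Hypothesis mu_supp : supp mu = [set: X].

(** The number t is a possible value at y for the second potential of a pair
    whose first potential is psi. *)
Definition admissible (L : R) (E : set X) (psi : X -> R) (y : Y) (t : R) : Prop :=
  [/\ measurable (E : set (borel X)), mu (~` E) = 0%E,
      mu.-integrable setT (EFin \o psi), - L <= \int[mu]_x psi x &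
      forall x a b, E x -> 0 <= a -> 0 <= b -> psi x * a + t * b <= h x y a b].

(** Near a point y0 with (x0, y0) in Omega, one radius s makes the difference
    quotients at (x, y0) smaller than - K on a set W of x that carries half of
    the mass of the slice of Omega; by uniform continuity this persists for y
    near y0.  If t came within d <= s of h x y 0 1, then psi <= 2 - K on W
    while psi is bounded above everywhere, and K is chosen so that this
    contradicts - L <= int psi.  Compactness of Y makes d uniform. *)
Lemma uniform_gap (L : R) : 0 <= L -> exists2 d : R, 0 < d &
  forall E psi y t x, admissible L E psi y t -> t + d <= h x y 0 1.
Proof.
move=> L0; have [C C0 hC] := cost_bounded cptX cptY h_cont.
have [Om [oO sO slope]] := h_slope.
pose P (d : R) (y : Y) := 0 < d ->
  forall E psi t x, admissible L E psi y t -> t + d <= h x y 0 1.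
suff : \forall d \near 0^'+, [set: Y] `<=` P d.
  move=> nearP; near (0 : R)^'+ => d; have d0 : 0 < d by [].
  exists d => // E psi y t x; have PY : [set: Y] `<=` P d by near: d.
  exact: PY.
move/compact_near_coveringP : (cptY); apply => y0 _.
have [x0 Oxy] : exists x0, Om (x0, y0).
  by have : [set: Y] y0 by []; rewrite -sO => -[[x y] /= + <-]; exists x.
pose U : set X := [set x | Om (x, y0)].
have oU : open U.
  apply: (@open_comp _ _ (fun x : X => (x, y0)) Om) => // x _.
  apply: pair_continuous; [by move=> ?; exact: cvg_id|exact: cst_continuous].
have mU : measurable (U : set (borel X)) by exact: borel_open.
have U0 : (0 < mu U)%E by have : [set: X] x0 by []; rewrite -mu_supp; apply.
pose m := fine (mu U).
have m0 : 0 < m by rewrite fine_gt0 // U0 ltey_eq fin_num_measure.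
pose M := fine (mu setT).
have M0 : 0 <= M by rewrite fine_ge0.
(* then (K - 2) m / 2 = C M + L + 1, the loss that W has to produce *)
pose K := 2 + 2 * (C * M + L + 1) / m.
pose q n (x : X) := (h x y0 n.+1%:R^-1 1 - h x y0 0 1) / n.+1%:R^-1.
have cont_slice a b : continuous (fun x => h x y0 a b).
  apply: (@continuous_comp_global _ _ _ (fun x : X => (x, (y0, (a, b)))) _ _ h_cont).
  by apply: pair_continuous; [by move=> ?; exact: cvg_id|exact: cst_continuous].
have cq n : continuous (q n).
  move=> x; apply: cvgM; last exact: cvg_cst.
  by apply: cvgB; exact: cont_slice.
have qoo x : U x -> q n x @[n --> \oo] --> -oo.
  move=> Ux; apply/cvgrNyPlt => A; have /cvgrNyPlt/(_ A)[e /= e0 he] := slope x y0 Ux.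
  near=> n; apply: he; last by rewrite /= invr_gt0.
  rewrite /= sub0r normrN gtr0_norm ?invr_gt0 //.
  by near: n; exact: near_infty_natSinv_lt (PosNum e0).
have [n] := half_measure_below (- K) mU U0 (fun n => continuous_borel_measurable (cq n)) qoo.
set W := U `&` _; set s := (n.+1%:R^-1 : R) => mW.
have s0 : 0 < s by rewrite invr_gt0.
have W_meas : measurable (W : set (borel X)).
  apply: measurableI => //; apply: borel_open.
  by apply: (@open_comp _ _ (q n) [set r | r < - K]) => [x _|]; [exact: cq|exact: open_lt].
have s20 : 0 < s / 2 by rewrite divr_gt0.
have near_y0 a b : \forall y \near y0, forall x, `|h x y a b - h x y0 a b| < s / 2.
  have cf : continuous (fun q : Y * X => h q.2 q.1 a b).
    apply: (@continuous_comp_global _ _ _ (fun q : Y * X => (q.2, (q.1, (a, b)))) _ _ h_cont).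
    apply: pair_continuous; first exact: snd_continuous.
    by apply: pair_continuous; [exact: fst_continuous|exact: cst_continuous].
  have := compact_uniform_near y0 cptX cf s20.
  by apply: filterS => y hy x; exact: hy.
near=> y d => /= d0 E psi t x [mE E0 Ipsi Lpsi psih].
have [//|gap] := leP (t + d) (h x y 0 1); exfalso.
have ds : d <= s by near: d; exact: nbhs_right_le.
have y1 : forall x, `|h x y s 1 - h x y0 s 1| < s / 2 by near: y; exact: near_y0.
have y2 : forall x, `|h x y 0 1 - h x y0 0 1| < s / 2 by near: y; exact: near_y0.
have psiC z : E z -> psi z <= C.
  move=> Ez; have := psih z 1 0 Ez ler01 (lexx _).
  by have := hC z y 1 0; rewrite !lexx !ler01; lra.
have psiW z : E z -> W z -> psi z <= 2 - K.
  move=> Ez [_ /=]; rewrite /q -/s ltr_pdivrMr // => qz.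
  have := psih z s 1 Ez (ltW s0) ler01; have := y1 z; have := y2 z.
  rewrite (h_vertex z x) !ltr_norml => /andP[? ?] /andP[? ?] ?.
  rewrite -(ler_pM2r s0); lra.
have IW : mu.-integrable setT (EFin \o (fun z => \1_W z : R)) by exact: integrable_indic.
have ICW : mu.-integrable setT (EFin \o (fun z => (C + K - 2) * \1_W z)).
  exact: (integrableZl measurableT (C + K - 2) IW).
have IC : mu.-integrable setT (EFin \o (fun=> C)) by exact: finite_measure_integrable_cst.
have : \int[mu]_z psi z <= \int[mu]_z (C - (C + K - 2) * \1_W z).
  apply: (le_Rintegral_full mE E0 Ipsi); first exact: (integrableB measurableT IC ICW).
  move=> z Ez; rewrite indicE; have [/set_mem Wz|_] := boolP (z \in W).
    by have := psiW z Ez Wz; rewrite mulr1; lra.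
  by have := psiC z Ez; rewrite mulr0; lra.
rewrite RintegralB // Rintegral_cst // RintegralZl //.
have -> : \int[mu]_z \1_W z = fine (mu W) by rewrite /Rintegral integral_indic // setIT.
apply/negP; rewrite -ltNge; apply: lt_le_trans Lpsi.
have K2 : (K - 2) * m = 2 * (C * M + L + 1).
  by rewrite /K [2 + _]addrC addrK divfK // gt_eqF.
have CM0 : 0 <= C * M by rewrite mulr_ge0.
have K20 : 0 <= K - 2 by rewrite -(pmulr_lge0 _ m0) K2; lra.
have CW0 : 0 <= C * fine (mu W) by rewrite mulr_ge0 // fine_ge0.
have := ler_wpM2l K20 mW; rewrite -/m -/M; lra.
Unshelve. all: by end_near. Qed.

End uniform_gap.

(** * Equicontinuous families *)

(** Pointwise limits along an ultrafilter exist by boundedness alone;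
    equicontinuity and compactness make the convergence uniform. *)
Lemma equicontinuous_ultralimit (R : realType) (X : topologicalType)
    (F : set_system nat) (f : nat -> X -> R) (M : R) :
  compact [set: X] -> UltraFilter F -> (forall n x, `|f n x| <= M) ->
  (forall x0 (e : R), 0 < e -> \forall x \near x0, forall n, `|f n x - f n x0| <= e) ->
  exists g : X -> R, [/\ continuous g, forall x, `|g x| <= M,
    forall x, f n x @[n --> F] --> g x &
    forall e : R, 0 < e -> \forall n \near F, forall x, `|f n x - g x| <= e].
Proof.
move=> cptX UF fM eqf; have PF : ProperFilter F by exact: ultra_proper.
have limx x : exists l : R, f n x @[n --> F] --> l.
  have FI : (f n x @[n --> F]) `[- M, M]%classic.
    by apply: nearW => n /=; rewrite in_itv /= -ler_norml.
  have [l [_ cl]] := @segment_compact R (- M) M _ _ FI.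
  (* an ultrafilter converges to each of its cluster points *)
  exists l => V Vl; have [//|nV] := in_ultra_setVsetC (f^~ x @^-1` V) UF.
  by have [y [/= nVy Vy]] := cl (~` V) V nV Vl.
pose g x := projT1 (cid (limx x)).
have fg x : f n x @[n --> F] --> g x by exact: projT2 (cid (limx x)).
have gM x : `|g x| <= M by apply: (cvgr_to_le (cvg_norm (fg x))); exact: nearW.
have eqg x0 (e : R) : 0 < e -> \forall x \near x0, `|g x - g x0| <= e.
  move=> e0; apply: filterS (eqf x0 e e0) => x fx.
  by apply: (cvgr_to_le (cvg_norm (cvgB (fg x) (fg x0)))); exact: nearW.
exists g; split=> //.
  move=> x0; apply/cvgrPdist_le => e e0.
  by apply: filterS (eqg x0 e e0) => x; rewrite distrC.
move=> e e0; have e30 : 0 < e / 3 by rewrite divr_gt0.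
suff : \forall n \near F, [set: X] `<=` (fun x => `|f n x - g x| <= e).
  by apply: filterS => n h x; exact: h.
move/compact_near_coveringP : cptX; apply => x0 _.
have fx0 : \forall n \near F, `|f n x0 - g x0| <= e / 3.
  have /cvgrPdist_le/(_ _ e30) := fg x0.
  by apply: filterS => n; rewrite distrC.
near=> x n.
have h1 : forall n, `|f n x - f n x0| <= e / 3 by near: x; exact: eqf.
have h2 : `|g x - g x0| <= e / 3 by near: x; exact: eqg.
have h3 : `|f n x0 - g x0| <= e / 3 by near: n.
have -> : f n x - g x = (f n x - f n x0) + (f n x0 - g x0) - (g x - g x0) by ring.
apply: le_trans (ler_normB _ _) _; have := ler_normD (f n x - f n x0) (f n x0 - g x0).
have := h1 n; lra.
Unshelve. all: by end_near. Qed.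

(** * Partitions into small cells of positive mass *)

(** Disjointify a finite open cover by sets satisfying Q and drop the null
    pieces. *)
Lemma finite_positive_partition (R : realType) (X : ptopologicalType)
    (mu : {finite_measure set (borel X) -> \bar R}) (Q : set X -> Prop) :
  compact [set: X] -> (forall A B, A `<=` B -> Q B -> Q A) ->
  (forall x, exists U, [/\ open U, U x & Q U]) ->
  exists (I : finType) (A : I -> set X),
    [/\ forall i, measurable (A i : set (borel X)),
        forall i, (0 < mu (A i))%E, forall i, Q (A i),
        forall i j x, A i x -> A j x -> i = j &
        mu (~` \bigcup_i A i) = 0%E].
Proof.
rewrite compact_cover => cptX Qsub /choice[U Uprop].
have [D _ cov] : finite_subset_cover [set: X] U [set: X].
  apply: cptX => [x _|x _]; first by have [] := Uprop x.
  by exists x => //; have [] := Uprop x.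
pose s : seq X := finmap.enum_fset D.
pose F n := if (n < size s)%N then U (nth point s n) else set0.
have mF n : measurable (F n : set (borel X)).
  by rewrite /F; case: ifP => // _; apply: borel_open; have [] := Uprop (nth point s n).
have mA n : measurable (seqDU F n : set (borel X)) by exact: seqDU_measurable.
pose K : finType := {k : 'I_(size s) | (0 < mu (seqDU F k))%E}.
exists K, (fun i : K => seqDU F (val (val i))); split.
- by [].
- by move=> [k].
- move=> [k k0] /=; apply: (@Qsub _ (U (nth point s k))); last first.
    by have [] := Uprop (nth point s k).
  by apply: subset_trans (@subset_seqDU _ F k) _; rewrite /F ltn_ord.
- move=> i j x Ai Aj; apply/val_inj/val_inj => /=.
  have /trivIsetP := trivIset_seqDU F.
  have [//|ij] := eqVneq (val (val i)) (val (val j)).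
  by move=> /(_ _ _ I I ij) ABE; have : set0 x by rewrite -ABE.
- apply: measure_negligible.
    by apply: measurableC; apply: fin_bigcup_measurable.
  pose N n := if (0 < mu (seqDU F n))%E then set0 else seqDU F n.
  apply: (@negligibleS _ _ _ mu (\bigcup_n N n)); last first.
    apply: negligible_bigcup => n; rewrite /N; case: ifPn => [_|]; first exact: negligible_set0.
    by rewrite -leNgt measure_le0 => /eqP n0; apply/negligibleP.
  move=> x nAx; have [y Dy Uyx] := cov x Logic.I.
  have : (\bigcup_k F k) x.
    by exists (index y s) => //; rewrite /F index_mem Dy nth_index.
  rewrite seqDU_bigcup_eq => -[n _ nx]; exists n => //; rewrite /N; case: ifPn => // n0.
  have ns : (n < size s)%N.
    by have := @subset_seqDU _ F n x nx; rewrite /F; case: ifP.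
  by apply: nAx; exists (exist _ (Ordinal ns) n0).
Qed.

(** * Metrizable spaces and regularity of Borel measures *)

Section metrizable_spaces.
Variable R : realType.

(** F n is the set of points at distance at least 1 / (n + 1) from the
    complement of W. *)
Lemma metrizable_open_Fsigma (T : topologicalType) (W : set T) : metrizable R T ->
  open W -> exists F : nat -> set T,
    [/\ forall n, closed (F n), nondecreasing_seq F & \bigcup_n F n = W].
Proof.
move=> [d [d0 _ dC dT nbhsd]] oW.
pose c n : R := n.+1%:R^-1; have c0 n : 0 < c n by rewrite invr_gt0.
pose F n := [set x | forall y, ~ W y -> c n <= d x y].
exists F; split.
- move=> n; rewrite -[F n]setCK; apply: open_closedC.
  rewrite openE => x /= /existsNP[y /not_implyP[nWy /negP]]; rewrite -ltNge => xy.
  rewrite /interior nbhsd; exists (c n - d x y); first by rewrite /= subr_gt0.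
  move=> z /= xz /(_ y nWy); apply/negP; rewrite -ltNge.
  by have := dT z x y; rewrite (dC z x); lra.
- move=> m n mn; apply/subsetPset => x Fx y nWy; apply: le_trans (Fx y nWy).
  by rewrite /c lef_pV2 ?posrE // ler_nat ltnS.
- apply/seteqP; split=> [x [n _ Fx]|x Wx].
    apply: contrapT => nWx; have := Fx x nWx; rewrite d0.
    by apply/negP; rewrite -ltNge.
  have : nbhs x W by rewrite openE in oW; exact: oW.
  rewrite nbhsd => -[e /= e0 eW].
  have [n _ ne] := near_infty_natSinv_lt (PosNum e0).
  exists n => // y nWy; rewrite leNgt; apply/negP => xy; apply: nWy; apply: eW => /=.
  by apply: lt_trans xy _; exact: (ne n (leqnn n)).
Qed.

Lemma metrizable_prod (T U : topologicalType) :
  metrizable R T -> metrizable R U -> metrizable R (T * U)%type.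
Proof.
move=> [d [d0 dI dC dT nbhsd]] [e [e0 eI eC eT nbhse]].
have dge0 x y : 0 <= d x y by have := dT x y x; rewrite d0 (dC y x); lra.
have ege0 x y : 0 <= e x y by have := eT x y x; rewrite e0 (eC y x); lra.
exists (fun p q => d p.1 q.1 + e p.2 q.2); split.
- by move=> p; rewrite d0 e0 addr0.
- move=> [x y] [x' y'] /= h; have := dge0 x x'; have := ege0 y y' => ? ?.
  by congr pair; [apply: dI|apply: eI]; lra.
- by move=> p q; rewrite dC eC.
- by move=> p q r; have := dT p.1 q.1 r.1; have := eT p.2 q.2 r.2; lra.
- move=> [x y]; apply/seteqP; split=> A.
    case=> -[P Q] /= []; rewrite nbhsd nbhse => -[r /= r0 rP] [s /= s0 sQ] PQ.
    exists (Num.min r s); first by rewrite /= lt_min r0.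
    move=> [x' y'] /=; rewrite lt_min => /andP[lr ls]; apply: (PQ (x', y')).
    split; [apply: rP|apply: sQ] => /=.
      by have := ege0 y y'; lra.
    by have := dge0 x x'; lra.
  case=> r /= r0 rA; have r20 : 0 < r / 2 by rewrite divr_gt0.
  exists ([set x' | d x x' < r / 2], [set y' | e y y' < r / 2]) => /=.
    by split; [rewrite nbhsd|rewrite nbhse]; exists (r / 2).
  by move=> [x' y'] /= [? ?]; apply: rA => /=; lra.
Qed.

(** The balls of radius 1 / (n + 1) around a finite 1 / (n + 1)-net, enumerated
    over all n. *)
Lemma metrizable_compact_countable_base (T : ptopologicalType) :
  metrizable R T -> compact [set: T] -> exists B : nat -> set T,
    (forall n, open (B n)) /\
    forall x (U : set T), open U -> U x -> exists n, B n x /\ B n `<=` U.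
Proof.
move=> [d [d0 dI dC dT nbhsd]] cT.
pose c n : R := n.+1%:R^-1; have c0 n : 0 < c n by rewrite invr_gt0.
pose ball n x := [set y | d x y < c n] : set T.
have oball n x : open (ball n x).
  rewrite openE => y /= xy; rewrite /interior nbhsd.
  exists (c n - d x y); first by rewrite /= subr_gt0.
  by move=> z /=; have := dT x y z; rewrite /ball /=; lra.
have fincov n : exists s : seq T, forall y, exists2 x, x \in s & ball n x y.
  move: cT; rewrite compact_cover => /(_ T [set: T] (ball n)) [x _|x _|D _ cov].
  - exact: oball.
  - by exists x => //; rewrite /ball /= d0.
  - exists (finmap.enum_fset D) => y; have [x Dx xy] := cov y Logic.I.
    by exists x.
have [s sP] := choice fincov.
pose B k := let nm := odflt (0, 0)%N (unpickle k) in ball nm.1 (nth point (s nm.1) nm.2).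
exists B; split=> [k|x U oU Ux]; first exact: oball.
have : nbhs x U by rewrite openE in oU; exact: oU.
rewrite nbhsd => -[r /= r0 rU].
have r20 : 0 < r / 2 by rewrite divr_gt0.
have [n _ /(_ n (leqnn n)) nr] := near_infty_natSinv_lt (PosNum r20).
have {}nr : c n < r / 2 by [].
have [z zs zx] := sP n x.
exists (pickle (n, index z (s n))); rewrite /B pickleK /= nth_index //; split=> // y.
move=> zy; apply: rU => /=; rewrite /ball /= in zx zy.
by have := dT x z y; rewrite (dC x z); lra.
Qed.

End metrizable_spaces.

Section regularity.
Variables (R : realType) (T : ptopologicalType).
Hypothesis metT : metrizable R T.
Variable nu : {finite_measure set (borel T) -> \bar R}.

Let measure_cap_lt (D : nat -> set T) (e : \bar R) :
  (forall n, measurable (D n : set (borel T))) -> nonincreasing_seq D ->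
  (nu (\bigcap_n D n) < e)%E -> exists n, (nu (D n) < e)%E.
Proof.
move=> mD niD De; apply: contrapT => /forallNP nD.
have mcap : measurable (\bigcap_n D n : set (borel T)) by exact: bigcapT_measurable.
have D0 : (nu (D 0%N) < +oo)%E by rewrite ltey_eq fin_num_measure.
have cD := nonincreasing_cvg_mu D0 mD mcap niD.
move: De; apply/negP; rewrite -leNgt -(cvg_lim _ cD) //.
apply: lime_ge; first by apply/cvg_ex; eexists; exact: cD.
by apply: nearW => n; rewrite leNgt; apply/negP; exact: nD.
Qed.

Definition regular_set (A : set T) := forall e : R, 0 < e ->
  exists F U : set T, [/\ closed F, open U, F `<=` A, A `<=` U & (nu (U `\` F) < e%:E)%E].

Let regular_open (W : set T) : open W -> regular_set W.
Proof.
move=> oW e e0; have [F [cF ndF FW]] := metrizable_open_Fsigma metT oW.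
have FW' n : F n `<=` W by move=> x Fx; rewrite -FW; exists n.
have [|||n nF] := @measure_cap_lt (fun n => W `\` F n) e%:E.
- by move=> n; apply: measurableD; [exact: borel_open|exact: borel_closed].
- by move=> m n mn; apply/subsetPset; apply: setDS; apply/subsetPset; exact: ndF.
- rewrite (_ : \bigcap_n (W `\` F n) = set0) ?measure0 //.
  apply/seteqP; split=> // x WF; have [Wx _] := WF 0%N Logic.I.
  by move: (Wx); rewrite -FW => -[n _ Fx]; have [] := WF n Logic.I.
- by exists (F n), W; split.
Qed.

Let regular_setC (A : set T) : regular_set A -> regular_set (~` A).
Proof.
move=> rA e e0; have [F [U [cF oU FA AU FU]]] := rA e e0.
exists (~` U), (~` F); split; [exact: open_closedC|exact: closed_openC| | |].
- exact: subsetC.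
- exact: subsetC.
- by rewrite setDE setCK setIC -setDE.
Qed.

Let regular_bigcup (A : nat -> set T) :
  (forall n, regular_set (A n)) -> regular_set (\bigcup_n A n).
Proof.
move=> rA e e0; pose eps n : R := e / 2 / (2 ^ n.+1)%:R.
have eps0 n : 0 < eps n by rewrite /eps !divr_gt0 // ltr0n expn_gt0.
have /choice[F /choice[U FU]] n : exists F U : set T, [/\ closed F, open U,
    F `<=` A n, A n `<=` U & (nu (U `\` F) < (eps n)%:E)%E] by exact: rA.
pose W := \bigcup_n U n.
have oW : open W by apply: bigcup_open => n _; have [] := FU n.
have mF n : measurable (F n : set (borel T)) by apply: borel_closed; have [] := FU n.
have mU n : measurable (U n : set (borel T)) by apply: borel_open; have [] := FU n.
pose G N := \big[setU/set0]_(n < N) F n.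
have mG N : measurable (G N : set (borel T)) by exact: bigsetU_measurable.
pose D N := W `\` G N.
have mD N : measurable (D N : set (borel T)).
  by apply: measurableD => //; exact: borel_open.
have niD : nonincreasing_seq D.
  move=> m n mn; apply/subsetPset; apply: setDS; rewrite /G.
  exact: subset_bigsetU.
have capD : (nu (\bigcap_N D N) < e%:E)%E.
  apply: (@le_lt_trans _ _ (e / 2)%:E); last by rewrite lte_fin; lra.
  apply: (@le_trans _ _ (\sum_(n <oo) nu (U n `\` F n))%E).
    apply: measure_sigma_subadditive => [n||x Dx].
    - exact: measurableD.
    - exact: bigcapT_measurable.
    - have [[n _ Ux] _] := Dx 0%N Logic.I; exists n => //; split=> // Fx.
      have [_] := Dx n.+1 Logic.I; apply.
      by rewrite /G big_ord_recr /=; right.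
  apply: le_trans (epsilon_trick0 xpredT (ltW (divr_gt0 e0 (ltr0n R 2)))).
  apply: lee_nneseries => [n _ _|n _]; first exact: measure_ge0.
  by apply: ltW; have [] := FU n.
have [N DN] := measure_cap_lt mD niD capD.
exists (G N), W; split=> //.
- by apply: closed_bigsetU => n _; have [] := FU n.
- rewrite /G => x; rewrite -bigcup_mkord => -[n _ Fx]; exists n => //.
  by have [_ _ + _ _] := FU n; apply.
- by move=> x [n _ Ax]; exists n => //; have [_ _ _ + _] := FU n; apply.
Qed.

(** The regular sets form a sigma-algebra, which contains the open sets because
    these are countable increasing unions of closed sets. *)
Lemma borel_regular (A : set (borel T)) : measurable A -> regular_set A.
Proof.
suff : <<s @open T >> `<=` regular_set by exact.
apply: smallest_sub; last exact: regular_open.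
split=> [|B|]; first by apply: regular_open; exact: open0.
  by rewrite setTD; exact: regular_setC.
exact: regular_bigcup.
Qed.

Lemma borel_inner_regular (A : set (borel T)) (e : R) : compact [set: T] ->
  measurable A -> 0 < e -> exists K : set T,
    [/\ closed K, compact K, K `<=` A & (nu (A `\` K) < e%:E)%E].
Proof.
move=> cT mA e0; have [F [U [cF oU FA AU UF]]] := borel_regular mA e0.
exists F; split=> //; first exact: (subclosed_compact cF cT).
apply: le_lt_trans UF; apply: le_measure; rewrite ?inE.
- by apply: measurableD => //; exact: borel_closed.
- by apply: measurableD; [exact: borel_open|exact: borel_closed].
- exact: setSD.
Qed.

End regularity.

(** * Image measures and product measures *)

Lemma finite_measure_ex d (T : measurableType d) (R : realType)
    (m : {measure set T -> \bar R}) : (m setT < +oo)%E ->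
  exists m' : {finite_measure set T -> \bar R}, (m' : set T -> \bar R) = m.
Proof.
move=> moo.
exists (mfrestr measurableT moo); apply/funext => A.
by rewrite -[LHS]/(m (A `&` setT)) setIT.
Qed.

Lemma finite_pushforward d1 d2 (T1 : measurableType d1) (T2 : measurableType d2)
    (R : realType) (m : {measure set T1 -> \bar R}) (f : T1 -> T2) :
  measurable_fun setT f -> (m setT < +oo)%E ->
  exists m' : {finite_measure set T2 -> \bar R}, (m' : set T2 -> \bar R) = pushforward m f.
Proof.
move=> mf moo; apply: finite_measure_ex => //.
Qed.

Section borel_product.
Variables (R : realType) (X Y : ptopologicalType).
Hypotheses (metX : metrizable R X) (cptX : compact [set: X]).

(** W is the union over a countable base (B n) of X of the rectangles
    B n `*` V n, where V n is the largest open set with B n `*` V n in W. *)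
Lemma open_prod_measurable (W : set (X * Y)) : open W ->
  measurable (W : set (borel X * borel Y)%type).
Proof.
move=> oW; have [B [oB basis]] := metrizable_compact_countable_base metX cptX.
pose V n := \bigcup_(v in [set v : set Y | open v /\ B n `*` v `<=` W]) v.
have -> : W = \bigcup_n (B n `*` V n).
  apply/seteqP; split=> [[x y] Wxy|[x y] [n _ [/= Bx [v [ov BvW] vy]]]]; last exact: BvW.
  have : nbhs (x, y) W by rewrite openE in oW; exact: oW.
  case=> -[P Q] /= [Px Qy] PQ.
  have [n [Bx BP]] := basis x P° (@open_interior _ P) Px.
  exists n => //; split=> //; exists Q°; last exact: Qy.
  split; first exact: open_interior.
  by move=> [x' y'] /= [Bx' Qy']; apply: PQ; split=> /=;
    [apply: interior_subset; exact: BP|exact: interior_subset].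
apply: bigcupT_measurable => n; apply: measurableX.
  exact: borel_open.
by apply: borel_open; apply: bigcup_open => v [].
Qed.

(** The product measure lives on the product sigma-algebra; it is transported to
    the Borel sets of the product topology. *)
Lemma borel_product_measure (mu1 : {finite_measure set (borel X) -> \bar R})
    (mu2 : {finite_measure set (borel Y) -> \bar R}) :
  exists nu : {finite_measure set (borel (X * Y)%type) -> \bar R},
  forall (A : set (borel X)) (B : set (borel Y)), measurable A -> measurable B ->
    nu (A `*` B) = (mu1 A * mu2 B)%E.
Proof.
pose f (p : (borel X * borel Y)%type) : borel (X * Y)%type := p.
have mf : measurable_fun setT f.
  apply: (@measurability _ _ _ _ setT f (@open (X * Y)%type)) => // _ [W oW <-].
  rewrite setTI.
  exact: open_prod_measurable.
have [|nu nuE] := finite_pushforward (m := (mu1 \x mu2)%E) mf.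
  rewrite (_ : _ setT = mu1 setT * mu2 setT)%E; last first.
    by rewrite -setXTT; exact: product_measure1E.
  by rewrite lte_mul_pinfty ?measure_ge0 // ?ltey_eq fin_num_measure.
by exists nu => A B mA mB; rewrite nuE; exact: product_measure1E.
Qed.

End borel_product.

(** * Integration against the image of a weighted measure *)

Section weighted_image.
Local Open Scope ereal_scope.
Context d1 d2 (S : measurableType d1) (T : measurableType d2) (R : realType).
Variables (alpha : {measure set S -> \bar R}) (mu : {measure set T -> \bar R}).
Variables (D : set S) (b : S -> T) (rho : S -> R).
Hypotheses (mD : measurable D) (mb : measurable_fun D b).
Hypotheses (mrho : measurable_fun D rho) (rho_ge0 : forall s, (0 <= rho s)%R).
Hypothesis muE : forall A, measurable A ->
  mu A = \int[alpha]_(s in D `&` b @^-1` A) (rho s)%:E.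

Import HBNNSimple.

(** Equality holds for simple functions by the hypothesis on mu, and the left
    hand side is the supremum of the integrals of the simple functions below
    f. *)
Lemma le_integral_weighted_image (f : T -> R) :
  measurable_fun setT f -> (forall t, (0 <= f t)%R) ->
  \int[mu]_t (f t)%:E <= \int[alpha]_(s in D) (rho s * f (b s))%:E.
Proof.
move=> mf f0; rewrite ge0_integralTE; last by move=> t; rewrite lee_fin.
apply: ge_ereal_sup => _ [h /= hf <-]; rewrite sintegralE.
pose g r s := (rho s)%:E * (r * \1_(h @^-1` [set r]) (b s))%:E.
have g0 r s : 0 <= g r s.
  by apply: mule_ge0; [rewrite lee_fin|rewrite EFinM nnfun_muleindic_ge0].
have mind r : measurable_fun D (fun s => \1_(h @^-1` [set r]) (b s) : R).
  by apply: measurableT_comp mb; exact: measurable_indic.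
have mg r : measurable_fun D (g r).
  apply: emeasurable_funM; first exact/measurable_EFinP.
  by apply/measurable_EFinP; apply: measurable_funM.
have gE r : range h r -> r%:E * mu (h @^-1` [set r]) = \int[alpha]_(s in D) g r s.
  move=> [t _ htr]; have r0 : (0 <= r)%R by rewrite -htr.
  transitivity (r%:E * \int[alpha]_(s in D) (rho s * \1_(h @^-1` [set r]) (b s))%:E).
    rewrite muE // integral_mkcondr; congr *%E; apply: eq_integral => s _.
    rewrite patchE indicE -[s \in _]/(b s \in h @^-1` [set r]).
    by case: ifP; rewrite ?mulr1 ?mulr0.
  rewrite -ge0_integralZl_EFin //.
  - by apply: eq_integral => s _; rewrite /g -!EFinM mulrCA.
  - by move=> s _; rewrite lee_fin mulr_ge0.
  - by apply/measurable_EFinP; apply: measurable_funM.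
rewrite [leLHS](_ : _ = \sum_(r \in range h) \int[alpha]_(s in D) g r s); last first.
  by apply: eq_fsbigr => r /set_mem; exact: gE.
rewrite -ge0_integral_fsum //.
have hE s : \sum_(r \in range h) g r s = (rho s * h (b s))%:E.
  rewrite fimfunE EFinM -fsumEFin // ge0_mule_fsumr // => r.
  by rewrite EFinM nnfun_muleindic_ge0.
under eq_integral do rewrite hE.
apply: ge0_le_integral => //.
- by move=> s _; rewrite lee_fin mulr_ge0.
- apply/measurable_EFinP; apply: measurable_funM; [exact: mrho|exact: measurableT_comp mb].
- apply/measurable_EFinP; apply: measurable_funM; [exact: mrho|exact: measurableT_comp mb].
- by move=> s _; rewrite lee_fin ler_wpM2l // -lee_fin.
Qed.

End weighted_image.

(** * Topology of the cone *)

Lemma continuous_cluster (T U : topologicalType) (f : T -> U) (p q : T) :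
  {for p, continuous f} -> {for q, continuous f} ->
  cluster (nbhs p) q -> cluster (nbhs (f p)) (f q).
Proof.
move=> fp fq pq A B pA qB; have [z [Az Bz]] := pq _ _ (fp _ pA) (fq _ qB).
by exists (f z).
Qed.

Lemma hausdorff_prod (T U : topologicalType) :
  hausdorff_space T -> hausdorff_space U -> hausdorff_space (T * U)%type.
Proof.
move=> hT hU p q pq; rewrite [p]surjective_pairing [q]surjective_pairing; congr pair.
- by apply: hT; apply: continuous_cluster pq; exact: fst_continuous.
- by apply: hU; apply: continuous_cluster pq; exact: snd_continuous.
Qed.

Lemma metrizable_hausdorff (R : realType) (T : topologicalType) :
  metrizable R T -> hausdorff_space T.
Proof.
move=> [d [d0 dI dC dT nbhsd]] x y xy; apply: dI.
have dge0 : 0 <= d x y by have := dT x y x; rewrite d0 (dC y x); lra.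
apply/eqP; rewrite eq_le dge0 andbT leNgt; apply/negP => xy0.
pose r := d x y / 2; have r0 : 0 < r by rewrite divr_gt0.
have nb z : nbhs z [set t | d z t < r] by rewrite nbhsd; exists r.
have [z [/= xz yz]] := xy _ _ (nb x) (nb y).
by have := dT x z y; rewrite (dC z y); rewrite /r in xz yz; lra.
Qed.

Section cone_topology.
Variables (R : realType) (X : ptopologicalType).
Local Notation C := (cone R X).
Local Open Scope quotient_scope.

Lemma nbhs_cone (p : C) : nbhs p = cone_nbhs p.
Proof. by []. Qed.

Lemma radius_continuous : continuous (@Defs.radius R X).
Proof.
move=> p V /nbhs_ballP[e /= e0 eV].
suff h : nbhs p [set q | `|Defs.radius p - Defs.radius q| < e].
  by apply: filterS h => q; exact: eV.
rewrite nbhs_cone /cone_nbhs.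
have [p0|p0] := ltP 0 (Defs.radius p).
  have cv : continuous (fun q : X * halfline R => \val q.2 : R).
    move=> q; apply: (@continuous_comp _ _ _ snd (fun r : halfline R => \val r)).
      exact: snd_continuous.
    exact: (@initial_continuous (halfline R) R \val).
  have /cvgrPdist_lt/(_ e e0) := cv (repr p).
  by apply: filterS => -[x r] /=; rewrite radius_pi.
exists e => // q /=; have -> : Defs.radius p = 0 by apply/eqP; rewrite eq_le p0 radius_ge0.
by rewrite sub0r normrN ger0_norm // radius_ge0.
Qed.

Lemma base_continuous_at (p : C) : 0 < Defs.radius p -> {for p, continuous (@base R X)}.
Proof.
move=> p0 V; rewrite /= nbhs_simpl nbhs_cone /cone_nbhs p0 => pV.
have cv : continuous (fun q : X * halfline R => \val q.2 : R).
  move=> q; apply: (@continuous_comp _ _ _ snd (fun r : halfline R => \val r)).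
    exact: snd_continuous.
  exact: (@initial_continuous (halfline R) R \val).
have n1 : nbhs (repr p) [set q : X * halfline R | 0 < \val q.2].
  exact: (cv (repr p) _ (lt_nbhsr p0)).
have n2 : nbhs (repr p) [set q : X * halfline R | V q.1].
  exact: (@fst_continuous X (halfline R) (repr p) _ pV).
apply: filterS (filterI n1 n2) => -[x r] /= [r0 Vx].
by rewrite /base repr_pi // gt_eqF.
Qed.

(** Two points that cannot be separated have the same radius, and the same base
    if that radius is positive. *)
Lemma cone_hausdorff : hausdorff_space X -> hausdorff_space C.
Proof.
move=> hX p q pq.
have rpq : Defs.radius p = Defs.radius q.
  by apply: (@Rhausdorff R); apply: continuous_cluster pq; exact: radius_continuous.
rewrite -[p]cone_ptK -[q]cone_ptK -rpq.
have [p0|p0] := ltP 0 (Defs.radius p); last first.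
  have -> : Defs.radius p = 0 by apply/eqP; rewrite eq_le p0 radius_ge0.
  by rewrite !cone_pt0.
congr cone_pt; apply: hX; apply: continuous_cluster pq; apply: base_continuous_at => //.
by rewrite -rpq.
Qed.

Lemma cone_pt_continuous : continuous (fun q : X * R => cone_pt R q.1 q.2).
Proof.
move=> [x r] V; rewrite /= nbhs_simpl nbhs_cone /cone_nbhs.
have cmax : continuous (fun q : X * R => Num.max 0 q.2).
  move=> q; apply: (@continuous_max R _ (fun=> 0) snd q); first exact: cst_continuous.
  exact: snd_continuous.
case: ifPn => r0.
  have c : continuous (fun q : X * R => (q.1, halfline_of (max0_ge0 q.2))).
    apply: pair_continuous; first exact: fst_continuous.
    by apply: (@continuous_comp_initial _ _ _ (\val : halfline R -> R)); exact: cmax.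
  rewrite repr_pi; last by move: r0; rewrite radius_pi => /gt_eqF ->.
  by move=> h; exact: (c (x, r) _ h).
case=> e /= e0 eV.
have : \forall q \near (x, r), Num.max 0 q.2 < e.
  apply: (cmax (x, r) [set s | s < e]); apply: lt_nbhsl => /=.
  by move: r0; rewrite radius_pi -leNgt /= => /le_lt_trans; apply.
by apply: filterS => q qe; apply: eV; rewrite /= radius_pi.
Qed.

End cone_topology.

(** * Piecewise continuous images of a measure *)

Lemma bigsetU_fintype (T : Type) (K : finType) (F : K -> set T) :
  \big[setU/set0]_k F k = \bigcup_k F k.
Proof.
apply/seteqP; split=> [|x [k _ Fk]]; last by rewrite (bigD1 k) //=; left.
apply: (big_ind (fun S => S `<=` \bigcup_k F k)) => // [S U SF UF|k _ x Fx].
  by move=> x [/SF|/UF].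
by exists k.
Qed.

Lemma measure_bigcup_fintype_le d (T : measurableType d) (R : realType)
    (mu : {measure set T -> \bar R}) (K : finType) (F : K -> set T) :
  (forall k, measurable (F k)) -> (mu (\bigcup_k F k) <= \sum_k mu (F k))%E.
Proof.
move=> mF; rewrite -bigsetU_fintype; elim: (index_enum K) => [|k s IH].
  by rewrite !big_nil measure0.
rewrite !big_cons; apply: le_trans (leeD2l _ IH); apply: measureU2 => //.
exact: bigsetU_measurable.
Qed.

Lemma continuous_borel (T S : ptopologicalType) (f : T -> S) :
  continuous f -> measurable_fun setT (f : borel T -> borel S).
Proof.
move=> cf; apply: (@measurability _ _ (borel T) (borel S) setT f (@open S)) => //.
move=> _ [W oW <-]; rewrite setTI; apply: borel_open; apply: open_comp => // z _.
Qed.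

(** The base map is continuous away from the vertex, and arbitrary there. *)
Lemma base_measurable (R : realType) (S X : ptopologicalType) (g : S -> cone R X) :
  continuous g -> measurable_fun ([set s | 0 < Defs.radius (g s)] : set (borel S))
    ((fun s => Defs.base (g s)) : borel S -> borel X).
Proof.
move=> cg; apply: (@measurability _ _ (borel S) (borel X) _ _ (@open X)) => //.
move=> _ [W oW <-]; apply: borel_open; rewrite openE => s /= [s0 Ws].
have n0 : nbhs s [set s | 0 < Defs.radius (g s)].
  exact: (cg s _ (radius_continuous (lt_nbhsr s0))).
have nW : nbhs s [set s | W (Defs.base (g s))].
  have nWs : nbhs (Defs.base (g s)) W by apply: open_nbhs_nbhs.
  exact: (cg s _ (base_continuous_at s0 nWs)).
exact: filterI n0 nW.
Qed.

Lemma positive_radius_measurable (R : realType) (S X : ptopologicalType)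
    (g : S -> cone R X) : continuous g ->
  measurable ([set s | 0 < Defs.radius (g s)] : set (borel S)).
Proof.
move=> cg; apply: borel_open.
apply: (@open_comp _ _ (fun s => Defs.radius (g s)) [set r | 0 < r]).
  by move=> s _; exact: (continuous_comp_global cg (@radius_continuous R X)).
exact: open_gt.
Qed.

Section piecewise_maps.
Variables (R : realType) (T S : ptopologicalType) (K : finType).
Variables (idx : T -> K) (f : K -> T -> S).
Hypothesis metT : metrizable R T.
Hypotheses (cptT : compact [set: T]) (hS : hausdorff_space S).
Hypothesis midx : forall k, measurable (idx @^-1` [set k] : set (borel T)).
Hypothesis cf : forall k, continuous (f k).
Variable nu : {finite_measure set (borel T) -> \bar R}.

Definition piecewise (z : T) : S := f (idx z) z.

Let mf k (A : set (borel S)) : measurable A -> measurable (f k @^-1` A : set (borel T)).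
Proof.
by move=> mA; have := continuous_borel (@cf k) measurableT mA; rewrite setTI.
Qed.

Lemma piecewise_preimage (A : set S) :
  piecewise @^-1` A = \bigcup_k (idx @^-1` [set k] `&` f k @^-1` A).
Proof.
apply/seteqP; split=> [z Az|z [k _ [/= <-]]] //.
by exists (idx z).
Qed.

Lemma piecewise_measurable : measurable_fun setT (piecewise : borel T -> borel S).
Proof.
move=> _ A mA; rewrite setTI piecewise_preimage.
by apply: fin_bigcup_measurable => // k _; apply: measurableI => //; exact: mf.
Qed.

(** In each piece, approximate the preimage of A from inside by a compact set;
    the map is continuous there, so the image of that set is compact. *)
Lemma piecewise_radon : radon (pushforward nu (piecewise : borel T -> borel S)).
Proof.
move=> A mA e e0; pose d : R := e / (#|K|.+1)%:R.
have d0 : 0 < d by rewrite divr_gt0.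
pose B k : set (borel T) := idx @^-1` [set k] `&` f k @^-1` A.
have mB k : measurable (B k) by apply: measurableI => //; exact: mf.
have /choice[L Lprop] k : exists L : set T,
    [/\ closed L, compact L, L `<=` B k & (nu (B k `\` L) < d%:E)%E].
  exact: (borel_inner_regular metT).
pose M := \bigcup_k (f k @` L k).
have cM : compact M.
  rewrite /M -bigsetU_fintype; apply: bigsetU_compact => k _.
  apply: continuous_compact; last by have [] := Lprop k.
  exact: continuous_subspaceT.
have mM : measurable (M : set (borel S)) by apply: borel_closed; exact: compact_closed.
have mL k : measurable (L k : set (borel T)) by apply: borel_closed; have [] := Lprop k.
exists M; split=> //.
  move=> _ [k _ [z Lz <-]]; have [_ _ LB _] := Lprop k.
  by have [] := LB z Lz.
rewrite /pushforward; apply: (@le_lt_trans _ _ (nu (\bigcup_k (B k `\` L k)))).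
  apply: le_measure; rewrite ?inE.
  - rewrite -[_ @^-1` _]setTI; apply: piecewise_measurable => //; exact: measurableD.
  - by apply: fin_bigcup_measurable => // k _; apply: measurableD.
  - move=> z [Az nMz]; exists (idx z) => //; split=> // Lz; apply: nMz.
    by exists (idx z) => //; exists z.
apply: le_lt_trans (measure_bigcup_fintype_le _ _) _ => [k|]; first exact: measurableD.
apply: (@le_lt_trans _ _ (\sum_(k : K) d%:E)%E).
  by apply: lee_sum => k _; apply: ltW; have [] := Lprop k.
rewrite sumEFin lte_fin sumr_const -mulr_natl /d mulrCA gtr_pMr //.
by rewrite ltr_pdivrMr // mul1r ltr_nat.
Qed.

Lemma fiber_measurable (g : K -> R) :
  measurable_fun setT ((fun z => g (idx z)) : borel T -> R).
Proof.
move=> _ Y mY; rewrite setTI.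
have -> : (fun z => g (idx z)) @^-1` Y = \bigcup_(k in [set k | Y (g k)]) idx @^-1` [set k].
  by apply/seteqP; split=> [z Yz|z [k /= Yk zk]]; [exists (idx z)|rewrite zk].
by apply: fin_bigcup_measurable => // k _; exact: midx.
Qed.

Lemma integral_fiber (g : K -> R) (E : set (borel T)) : measurable E ->
  (forall k, 0 <= g k) ->
  (\int[nu]_(z in E) (g (idx z))%:E = \sum_k (g k)%:E * nu (E `&` idx @^-1` [set k]))%E.
Proof.
move=> mE g0.
have gE z : (g (idx z))%:E = (\sum_k (g k * \1_(idx @^-1` [set k]) z)%:E)%E.
  rewrite (bigD1 (idx z)) //= big1 ?adde0; last first.
    move=> k kz; rewrite indicE memNset ?mulr0 //= => zk.
    by move: kz; rewrite zk eqxx.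
  by rewrite indicE mem_set // mulr1.
under eq_integral do rewrite gE.
rewrite ge0_integral_sum //.
- apply: eq_bigr => k _; under eq_integral do rewrite EFinM.
  rewrite ge0_integralZl_EFin //; first by rewrite integral_indic // setIC.
  by apply/measurable_EFinP; exact: measurable_indic.
- move=> k; apply/measurable_EFinP; apply: measurable_funM; first exact: measurable_cst.
  exact: measurable_indic.
- by move=> k z _; rewrite lee_fin mulr_ge0.
Qed.

(** If g sends the k-th piece to cone points over q z of constant radius rho k,
    the integral of the radius is a finite sum. *)
Lemma piecewise_marginal (X : ptopologicalType) (g : S -> cone R X) (q : T -> X)
    (rho : K -> R) (A : set (borel X)) :
  continuous g -> continuous q -> (forall k, 0 <= rho k) ->
  (forall k z, g (f k z) = cone_pt R (q z) (rho k)) -> measurable A ->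
  (\int[pushforward nu (piecewise : borel T -> borel S)]_(s in
      [set s | (0 < Defs.radius (g s))%R /\ A (Defs.base (g s))]) (Defs.radius (g s))%:E =
   \sum_k (rho k)%:E * nu (q @^-1` A `&` idx @^-1` [set k]))%E.
Proof.
move=> cg cq rho0 gf mA; rewrite ge0_integral_pushforward.
- rewrite -integral_fiber //; last first.
    by have := continuous_borel cq measurableT mA; rewrite setTI.
  rewrite integral_mkcond [RHS]integral_mkcond; apply: eq_integral => z _.
  rewrite !patchE /= /piecewise gf radius_cone_pt //.
  have [r0|r0] := ltP 0 (rho (idx z)).
    suff -> : (z \in piecewise @^-1` [set s | 0 < Defs.radius (g s) /\ A (Defs.base (g s))])
        = (z \in q @^-1` A) by [].
    apply/idP/idP => /set_mem /= zA; apply/mem_set => /=.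
      by have [_] := zA; rewrite /piecewise gf base_cone_pt.
    by rewrite /piecewise gf base_cone_pt // radius_cone_pt.
  have -> : rho (idx z) = 0 by apply/eqP; rewrite eq_le r0 rho0.
  by case: ifP; case: ifP.
- exact: piecewise_measurable.
- exact: (base_measurable cg) (positive_radius_measurable cg) _ mA.
- apply/measurable_EFinP; apply: measurable_funTS.
  apply: continuous_borel_measurable.
  exact: continuous_comp_global cg (@radius_continuous R X).
- by move=> s _; rewrite lee_fin radius_ge0.
Qed.
End piecewise_maps.

(** * The plan attached to a pair of matrices *)

Lemma measure_partition d (T : measurableType d) (R : realType)
    (mu : {measure set T -> \bar R}) (I : finType) (A : I -> set T) (E : set T) :
  (forall i, measurable (A i)) -> (forall i j x, A i x -> A j x -> i = j) ->
  mu (~` \bigcup_i A i) = 0%E -> measurable E ->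
  mu E = (\sum_i mu (E `&` A i))%E.
Proof.
move=> mA dA null mE.
have mU : measurable (\bigcup_i A i) by exact: fin_bigcup_measurable.
rewrite -{1}[E](setIT E) -(setUv (\bigcup_i A i)) setIUr measureU; last 3 first.
- exact: measurableI.
- by apply: measurableI => //; exact: measurableC.
- by rewrite setIACA setICr setI0.
rewrite [X in (_ + X)%E](_ : _ = 0%E) ?adde0; last first.
  apply/eqP; rewrite -measure_le0 -null; apply: le_measure; rewrite ?inE.
  - by apply: measurableI => //; exact: measurableC.
  - exact: measurableC.
  - exact: subIsetr.
rewrite setI_bigcupr measure_fin_bigcup //.
- rewrite (_ : [set: I] = [set` index_enum I]) -?fsbig_seq ?index_enum_uniq //.
  by apply/seteqP; split=> // i _; exact: mem_index_enum.
- exact: finite_finset.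
- apply/trivIsetP => i j _ _ ij; apply/seteqP; split=> // x [[_ Ai] [_ Aj]].
  by move: ij; rewrite (dA _ _ _ Ai Aj) eqxx.
- by move=> i _; exact: measurableI.
Qed.

Lemma sum_option (V : nmodType) (K : finType) (F : option K -> V) :
  \sum_o F o = F None + \sum_k F (Some k).
Proof.
rewrite (bigD1 None) //=; congr (_ + _).
rewrite (reindex_omap Some id) /=; last by case.
by apply: eq_bigl => k; rewrite eqxx.
Qed.

Section plan.
Variables (R : realType) (X1 X2 : ptopologicalType).
Hypotheses (metX1 : metrizable R X1) (metX2 : metrizable R X2).
Hypotheses (cptX1 : compact [set: X1]) (cptX2 : compact [set: X2]).
Variable H : cone R X1 * cone R X2 -> R.
Hypotheses (H_ge0 : forall p, 0 <= H p) (H_cont : continuous H).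
Hypothesis H_vertex : H (vertex R X1, vertex R X2) = 0.
Variable mu1 : {finite_measure set (borel X1) -> \bar R}.
Variable mu2 : {finite_measure set (borel X2) -> \bar R}.
Variables (I J : finType) (A : I -> set X1) (B : J -> set X2).
Hypotheses (mA : forall i, measurable (A i : set (borel X1)))
           (mB : forall j, measurable (B j : set (borel X2))).
Hypotheses (A_gt0 : forall i, (0 < mu1 (A i))%E) (B_gt0 : forall j, (0 < mu2 (B j))%E).
Hypotheses (A_disj : forall i i' x, A i x -> A i' x -> i = i')
           (B_disj : forall j j' y, B j y -> B j' y -> j = j').
Hypotheses (A_full : mu1 (~` \bigcup_i A i) = 0%E) (B_full : mu2 (~` \bigcup_j B j) = 0%E).
Variables a b : I -> J -> R.
Hypotheses (a_ge0 : forall i j, 0 <= a i j) (b_ge0 : forall i j, 0 <= b i j).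
Let m i := fine (mu1 (A i)).
Let n j := fine (mu2 (B j)).
Hypotheses (a_sum : forall i, \sum_j a i j = m i) (b_sum : forall j, \sum_i b i j = n j).
Variable c : I -> J -> R.
Hypothesis H_le : forall i j x y, A i x -> B j y ->
  H (cone_pt R x (a i j / (m i * n j)), cone_pt R y (b i j / (m i * n j))) <=
  c i j / (m i * n j).

Let m_gt0 i : 0 < m i.
Proof. by rewrite fine_gt0 // A_gt0 ltey_eq fin_num_measure. Qed.
Let n_gt0 j : 0 < n j.
Proof. by rewrite fine_gt0 // B_gt0 ltey_eq fin_num_measure. Qed.
Let mn_gt0 i j : 0 < m i * n j.
Proof. exact: mulr_gt0. Qed.

Let idx (z : X1 * X2) : option (I * J) :=
  [pick k : I * J | (z.1 \in A k.1) && (z.2 \in B k.2)].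

Let idx_Some k : idx @^-1` [set Some k] = A k.1 `*` B k.2.
Proof.
apply/seteqP; rewrite /idx; split=> z /=.
  by case: pickP => // k' /andP[/set_mem ? /set_mem ?] [<-].
move=> [Az Bz]; case: pickP => [k' /andP[/set_mem Az' /set_mem Bz']|/(_ k)].
  congr Some; rewrite [k]surjective_pairing [k']surjective_pairing.
  by rewrite (A_disj Az Az') (B_disj Bz Bz').
by rewrite !mem_set.
Qed.

Let idx_None : idx @^-1` [set None] = ~` \bigcup_k (A k.1 `*` B k.2).
Proof.
apply/seteqP; split=> z /=.
  by move=> zN [k _]; rewrite -idx_Some /= zN.
move=> nz; case E : (idx z) => [k|//]; exfalso; apply: nz; exists k => //.
by rewrite -idx_Some.
Qed.

Let midx o : measurable (idx @^-1` [set o] : set (borel (X1 * X2)%type)).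
Proof.
have mSome (k : I * J) : measurable (A k.1 `*` B k.2 : set (borel (X1 * X2)%type)).
  have := continuous_borel (@fst_continuous X1 X2) measurableT (mA k.1).
  have := continuous_borel (@snd_continuous X1 X2) measurableT (mB k.2).
  by rewrite !setTI => mB' mA'; exact: measurableI.
case: o => [k|]; first by rewrite idx_Some.
rewrite idx_None; apply: measurableC; exact: fin_bigcup_measurable.
Qed.

Let weight (w : I -> J -> R) (o : option (I * J)) : R :=
  if o is Some k then w k.1 k.2 / (m k.1 * n k.2) else 0.

Let weight_ge0 w : (forall i j, 0 <= w i j) -> forall o, 0 <= weight w o.
Proof. by move=> w0 [[i j]|] //=; rewrite divr_ge0 // ltW. Qed.

Let f o (z : X1 * X2) := (cone_pt R z.1 (weight a o), cone_pt R z.2 (weight b o)).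

Let cf o : continuous (f o).
Proof.
have cp (X : ptopologicalType) (r : R) : continuous (fun x : X => cone_pt R x r).
  apply: (@continuous_comp_global _ _ _ (fun x : X => (x, r)) _ _ (@cone_pt_continuous R X)).
  by apply: pair_continuous; [move=> ?; exact: cvg_id|exact: cst_continuous].
apply: pair_continuous.
  exact: continuous_comp_global (@fst_continuous X1 X2) (cp X1 _).
exact: continuous_comp_global (@snd_continuous X1 X2) (cp X2 _).
Qed.

(** Send (x, y) in A i `*` B j to the pair of cone points over x and y with
    radii a i j / (m i n j) and b i j / (m i n j), and all other points to the
    vertices.  The mass of A i `*` B j is m i n j, so the first marginal of A i
    receives the sum over j of a i j, which is m i; the cost is 1-homogeneous,
    so the denominators cancel in the integral of H too. *)
Lemma discrete_plan : exists2 alpha, homogeneous_plans mu1 mu2 alpha &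
  (\int[alpha]_p (H p)%:E <= (\sum_i \sum_j c i j)%:E)%E.
Proof.
have metZ := metrizable_prod metX1 metX2.
have cptZ : compact [set: X1 * X2] by rewrite -setXTT; exact: compact_setX.
have [nu nuE] := borel_product_measure metX1 cptX1 mu1 mu2.
have mpiecewise := @piecewise_measurable _ _ _ _ _ midx cf.
have [|alpha alphaE] := finite_pushforward (m := nu) mpiecewise.
  exact: fin_num_fun_lty.
have hS : hausdorff_space (cone R X1 * cone R X2)%type.
  by apply: hausdorff_prod; apply: cone_hausdorff;
    [exact: metrizable_hausdorff metX1|exact: metrizable_hausdorff metX2].
have nu_fiber E1 E2 (k : I * J) : measurable (E1 : set (borel X1)) ->
    measurable (E2 : set (borel X2)) ->
    nu ((E1 `*` E2) `&` idx @^-1` [set Some k]) =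
    (mu1 (E1 `&` A k.1) * mu2 (E2 `&` B k.2))%E.
  move=> mE1 mE2; rewrite idx_Some -nuE; [|exact: measurableI..].
  by congr (nu _); apply/seteqP; split=> z /= [[? ?] [? ?]].
have fst_rect (E : set X1) : fst @^-1` E = E `*` [set: X2] by apply/seteqP; split=> z //= [].
have snd_rect (E : set X2) : snd @^-1` E = [set: X1] `*` E by apply/seteqP; split=> z //= [].
have fineK1 (E : set (borel X1)) : measurable E -> mu1 E = (fine (mu1 E))%:E.
  by move=> mE; rewrite fineK // fin_num_measure.
have fineK2 (E : set (borel X2)) : measurable E -> mu2 E = (fine (mu2 E))%:E.
  by move=> mE; rewrite fineK // fin_num_measure.
have radius_cont1 : continuous (fun p : cone R X1 * cone R X2 => Defs.radius p.1).
  exact: continuous_comp_global (@fst_continuous _ _) (@radius_continuous R X1).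
have radius_cont2 : continuous (fun p : cone R X1 * cone R X2 => Defs.radius p.2).
  exact: continuous_comp_global (@snd_continuous _ _) (@radius_continuous R X2).
exists alpha; last first.
  have c_ge0 i j : 0 <= c i j.
    have [x Ax] : A i !=set0.
      by apply/set0P/eqP => A0; move: (A_gt0 i); rewrite A0 measure0 ltxx.
    have [y By] : B j !=set0.
      by apply/set0P/eqP => B0; move: (B_gt0 j); rewrite B0 measure0 ltxx.
    have := le_trans (H_ge0 _) (H_le Ax By).
    by rewrite (ler_pdivlMr _ _ (mn_gt0 i j)) mul0r.
  rewrite alphaE ge0_integral_pushforward //; last 2 first.
  - by apply/measurable_EFinP; exact: continuous_borel_measurable.
  - by move=> p _; rewrite lee_fin.
  rewrite preimage_setT.
  apply: (@le_trans _ _ (\int[nu]_z (weight c (idx z))%:E)%E).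
    apply: ge0_le_integral => //.
    - by move=> z _; rewrite lee_fin.
    - apply/measurable_EFinP; apply: (measurableT_comp _ mpiecewise).
      exact: continuous_borel_measurable.
    - by apply/measurable_EFinP; exact: (fiber_measurable midx).
    - move=> z _; rewrite lee_fin /= /piecewise; case E : (idx z) => [k|] /=.
        have : (idx @^-1` [set Some k]) z by [].
        by rewrite idx_Some => -[Az Bz]; exact: H_le.
      by rewrite /f /= !cone_pt0 H_vertex.
  rewrite (integral_fiber midx nu measurableT (weight_ge0 c_ge0)) sum_option mul0e add0e.
  rewrite pair_bigA -sumEFin /=; apply: lee_sum => k _.
  rewrite setTI idx_Some nuE // (fineK1 _ (mA _)) (fineK2 _ (mB _)) -!EFinM lee_fin.
  by rewrite divfK // gt_eqF.
split.
- rewrite alphaE; exact: (piecewise_radon metZ cptZ hS midx cf).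
- rewrite alphaE ge0_integral_pushforward //; last 2 first.
  + apply/measurable_EFinP; apply: continuous_borel_measurable => p.
    exact: cvgD (radius_cont1 p) (radius_cont2 p).
  + by move=> p _; rewrite lee_fin addr_ge0 // radius_ge0.
  pose g o := weight a o + weight b o.
  have g0 o : 0 <= g o by rewrite addr_ge0 // weight_ge0.
  rewrite preimage_setT.
  rewrite (eq_integral (fun z : borel (X1 * X2)%type => (g (idx z))%:E)); last first.
    by move=> z _; rewrite /= /piecewise /f /= !radius_cone_pt // weight_ge0.
  rewrite (integral_fiber midx nu measurableT g0).
  apply: lte_sum_pinfty => o _; rewrite lte_mul_pinfty ?lee_fin //.
  by rewrite ltey_eq fin_num_measure //; exact: measurableI.
- move=> E mE; rewrite /marginal1 alphaE.
  rewrite (@piecewise_marginal _ _ _ _ _ _ midx cf nu _ fst fst _ E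
    (@fst_continuous _ _) (@fst_continuous _ _) (weight_ge0 a_ge0)) //.
  rewrite sum_option mul0e add0e (measure_partition mA A_disj A_full mE).
  rewrite [RHS](eq_bigr (fun k => ((a k.1 k.2 / m k.1) * fine (mu1 (E `&` A k.1)))%:E)).
    rewrite -(pair_bigA _ (fun i j => (a i j / m i * fine (mu1 (E `&` A i)))%:E)) /=.
    apply: eq_bigr => i _; rewrite sumEFin -!mulr_suml a_sum divff ?gt_eqF // mul1r.
    by apply: fineK1; exact: measurableI.
  move=> k _; rewrite fst_rect nu_fiber // setTI (fineK2 _ (mB _)).
  rewrite (fineK1 _ (measurableI _ _ mE (mA _))).
  rewrite -!EFinM /=; congr EFin; rewrite -/(n _).
  by field; rewrite !gt_eqF.
- move=> E mE; rewrite /marginal2 alphaE.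
  rewrite (@piecewise_marginal _ _ _ _ _ _ midx cf nu _ snd snd _ E
    (@snd_continuous _ _) (@snd_continuous _ _) (weight_ge0 b_ge0)) //.
  rewrite sum_option mul0e add0e (measure_partition mB B_disj B_full mE).
  rewrite [RHS](eq_bigr (fun k => ((b k.1 k.2 / n k.2) * fine (mu2 (E `&` B k.2)))%:E)).
    rewrite -(pair_bigA _ (fun i j => (b i j / n j * fine (mu2 (E `&` B j)))%:E)) /=.
    rewrite exchange_big; apply: eq_bigr => j _ /=.
    rewrite sumEFin -!mulr_suml b_sum divff ?gt_eqF // mul1r.
    by apply: fineK2; exact: measurableI.
  move=> k _; rewrite snd_rect nu_fiber // setTI (fineK1 _ (mA _)).
  rewrite (fineK2 _ (measurableI _ _ mE (mB _))).
  rewrite -!EFinM /=; congr EFin; rewrite -/(m _).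
  by field; rewrite !gt_eqF.
Qed.

End plan.

(** * Weak duality *)

Lemma ge0_integral_support d (T : measurableType d) (R : realType)
    (mu : {measure set T -> \bar R}) (D : set T) (f : T -> \bar R) :
  (forall x, ~ D x -> f x = 0%E) -> (\int[mu]_(x in D) f x = \int[mu]_x f x)%E.
Proof.
move=> f0; rewrite integral_mkcond; apply: eq_integral => x _; rewrite patchE.
by case: ifPn => // /negP; rewrite inE => /f0 ->.
Qed.

(** A plan on S = C[X1] x C[X2] is seen through one of its two projections g, so
    that both marginal conditions are instances of the same hypothesis. *)
Section coordinate.
Variables (R : realType) (S X : ptopologicalType) (g : S -> cone R X).
Hypothesis cg : continuous g.
Variable alpha : {finite_measure set (borel S) -> \bar R}.
Variable mu : {finite_measure set (borel X) -> \bar R}.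
Hypothesis muE : forall A : set (borel X), measurable A -> mu A =
  (\int[alpha]_(s in [set s | (0 < Defs.radius (g s))%R /\ A (Defs.base (g s))])
    (Defs.radius (g s))%:E)%E.

Let D : set (borel S) := [set s | 0 < Defs.radius (g s)].
Let mD : measurable D. Proof. exact: positive_radius_measurable. Qed.

Let radius_out s : ~ D s -> Defs.radius (g s) = 0.
Proof. by move/negP; rewrite -leNgt => h; apply/eqP; rewrite eq_le h radius_ge0. Qed.

Lemma radius_measurable : measurable_fun setT ((fun s => Defs.radius (g s)) : borel S -> R).
Proof.
apply: continuous_borel_measurable; exact: continuous_comp_global cg (@radius_continuous R X).
Qed.

Lemma integral_radius : (\int[alpha]_s (Defs.radius (g s))%:E = mu setT)%E.
Proof.
rewrite muE // -(@ge0_integral_support _ _ _ _ D) => [|s /radius_out ->//].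
by congr (integral _ _ _); apply/seteqP; split=> s //= -[].
Qed.

Lemma weighted_base_measurable (f : X -> R) : continuous f ->
  measurable_fun setT ((fun s => Defs.radius (g s) * f (Defs.base (g s))) : borel S -> R).
Proof.
move=> cf; have -> : (fun s => Defs.radius (g s) * f (Defs.base (g s))) =
    (fun s => Defs.radius (g s) * f (Defs.base (g s))) \_ D.
  apply/funext => s; rewrite patchE; case: ifPn => // /negP; rewrite inE => /radius_out ->.
  by rewrite mul0r.
apply: (iffLR (measurable_restrictT _ mD)); apply: measurable_funM.
  exact: measurable_funTS radius_measurable.
apply: measurableT_comp (continuous_borel_measurable cf) _; exact: base_measurable.
Qed.

Lemma le_integral_base (f : X -> R) : continuous f -> (forall x, 0 <= f x) ->
  (\int[mu]_x (f x)%:E <= \int[alpha]_s (Defs.radius (g s) * f (Defs.base (g s)))%:E)%E.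
Proof.
move=> cf f0; rewrite -(@ge0_integral_support _ _ _ _ D) => [|s /radius_out ->]; last first.
  by rewrite mul0r.
apply: (@le_integral_weighted_image _ _ _ _ _ alpha mu D (fun s => Defs.base (g s))
  (fun s => Defs.radius (g s))) => //.
- exact: base_measurable.
- exact: measurable_funTS radius_measurable.
- by move=> s; exact: radius_ge0.
- exact: continuous_borel_measurable.
Qed.

End coordinate.

Section weak_duality.
Variables (R : realType) (X1 X2 : ptopologicalType).
Variable H : cone R X1 * cone R X2 -> R.
Hypotheses (H_ge0 : forall p, 0 <= H p) (H_cont : continuous H).
Variable mu1 : {finite_measure set (borel X1) -> \bar R}.
Variable mu2 : {finite_measure set (borel X2) -> \bar R}.

Lemma continuous_bounded_integrable (X : ptopologicalType)
    (mu : {finite_measure set (borel X) -> \bar R}) (f : X -> R) (M : R) :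
  continuous f -> (forall x, `|f x| <= M) -> mu.-integrable setT (EFin \o f).
Proof.
by move=> cf; apply: (@bounded_integrable _ (borel X)); exact: continuous_borel_measurable.
Qed.

(** Adding the bound M to both potentials makes all integrands nonnegative; both
    sides of the inequality then grow by M (mu1 X1 + mu2 X2), as the radii
    integrate to the total masses. *)
Lemma weak_duality (phi1 : X1 -> R) (phi2 : X2 -> R) (M : R) :
  continuous phi1 -> continuous phi2 ->
  (forall x, `|phi1 x| <= M) -> (forall y, `|phi2 y| <= M) ->
  (forall x1 x2 r1 r2, 0 <= r1 -> 0 <= r2 ->
    phi1 x1 * r1 + phi2 x2 * r2 <= H (cone_pt R x1 r1, cone_pt R x2 r2)) ->
  ((\int[mu1]_x phi1 x + \int[mu2]_y phi2 y)%:E <= UH H mu1 mu2)%E.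
Proof.
move=> c1 c2 M1 M2 feas; apply: le_ereal_inf_tmp => _ [alpha [_ _ mu1E mu2E] <-].
have [IH|IH] := eqVneq (\int[alpha]_p (H p)%:E)%E +oo%E; first by rewrite IH leey.
have M0 : 0 <= M by apply: le_trans (M1 point).
pose f1 x := phi1 x + M; pose f2 y := phi2 y + M.
have cf1 : continuous f1 by move=> x; apply: cvgD (c1 x) (cvg_cst _).
have cf2 : continuous f2 by move=> x; apply: cvgD (c2 x) (cvg_cst _).
have f1_ge0 x : 0 <= f1 x by have := M1 x; rewrite ler_norml /f1 => /andP[]; lra.
have f2_ge0 x : 0 <= f2 x by have := M2 x; rewrite ler_norml /f2 => /andP[]; lra.
have cfst : continuous (@fst (cone R X1) (cone R X2)) by exact: fst_continuous.
have csnd : continuous (@snd (cone R X1) (cone R X2)) by exact: snd_continuous.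
have le1 := le_integral_base cfst mu1E cf1 f1_ge0.
have le2 := le_integral_base csnd mu2E cf2 f2_ge0.
have If (X : ptopologicalType) (mu : {finite_measure set (borel X) -> \bar R})
    (phi : X -> R) : continuous phi -> (forall x, `|phi x| <= M) ->
    (\int[mu]_x (phi x + M)%:E = (\int[mu]_x phi x + M * fine (mu setT))%:E)%E.
  move=> cp pM; have Ip := continuous_bounded_integrable mu cp pM.
  have IM : mu.-integrable setT (EFin \o (fun=> M)) by exact: finite_measure_integrable_cst.
  rewrite integralD_EFin // EFinD /Rintegral fineK ?integrable_fin_num //.
  by rewrite integral_cst // EFinM fineK // fin_num_measure.
rewrite [leLHS](If _ mu1 _ c1 M1) in le1; rewrite [leLHS](If _ mu2 _ c2 M2) in le2.
have mH : measurable_fun setT (H : borel (cone R X1 * cone R X2)%type -> R).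
  exact: continuous_borel_measurable.
have mr1 := radius_measurable cfst; have mr2 := radius_measurable csnd.
have mw1 := weighted_base_measurable cfst cf1.
have mw2 := weighted_base_measurable csnd cf2.
have r_ge0 := @radius_ge0.
have upper : (\int[alpha]_p (Defs.radius p.1 * f1 (Defs.base p.1))%:E +
    \int[alpha]_p (Defs.radius p.2 * f2 (Defs.base p.2))%:E <=
    \int[alpha]_p (H p)%:E + (M%:E * mu1 setT + M%:E * mu2 setT))%E.
  rewrite -(integral_radius mu1E) -(integral_radius mu2E).
  have mMr1 : measurable_fun setT ((fun p => M%:E * (Defs.radius p.1)%:E)%E
    : borel (cone R X1 * cone R X2)%type -> \bar R).
    by apply: measurable_funeM; exact/measurable_EFinP.
  have mMr2 : measurable_fun setT ((fun p => M%:E * (Defs.radius p.2)%:E)%E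
    : borel (cone R X1 * cone R X2)%type -> \bar R).
    by apply: measurable_funeM; exact/measurable_EFinP.
  have Mr_ge0 (X : ptopologicalType) (p : cone R X) : (0 <= M%:E * (Defs.radius p)%:E)%E.
    by rewrite -EFinM lee_fin mulr_ge0 ?radius_ge0.
  have w_ge0 (X : ptopologicalType) (p : cone R X) (f : X -> R) : (forall x, 0 <= f x) ->
      (0 <= (Defs.radius p * f (Defs.base p))%:E)%E.
    by move=> f0; rewrite lee_fin mulr_ge0 ?radius_ge0.
  rewrite -!ge0_integralZl_EFin //;
    [|by move=> p _; rewrite lee_fin radius_ge0|exact/measurable_EFinP
     |by move=> p _; rewrite lee_fin radius_ge0|exact/measurable_EFinP].
  rewrite -ge0_integralD //;
    [|by move=> p _; exact: w_ge0|exact/measurable_EFinP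
     |by move=> p _; exact: w_ge0|exact/measurable_EFinP].
  rewrite -[X in (_ <= _ + X)%E]ge0_integralD // -ge0_integralD //;
    [|by move=> p _; rewrite lee_fin|exact/measurable_EFinP
     |by move=> p _; exact: adde_ge0|exact: emeasurable_funD].
  apply: ge0_le_integral => //.
  - by move=> p _; apply: adde_ge0; exact: w_ge0.
  - by apply: emeasurable_funD; exact/measurable_EFinP.
  - apply: emeasurable_funD; first exact/measurable_EFinP.
    exact: emeasurable_funD.
  - move=> p _; rewrite -!EFinM -!EFinD lee_fin /f1 /f2.
    have := feas (Defs.base p.1) (Defs.base p.2) _ _ (r_ge0 _ _ p.1) (r_ge0 _ _ p.2).
    rewrite !cone_ptK -surjective_pairing; lra.
have := le_trans (leeD le1 le2) upper.
have IHfin : (\int[alpha]_p (H p)%:E)%E \is a fin_num.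
  by rewrite ge0_fin_numE ?ltey // integral_ge0 // => p _; rewrite lee_fin.
have [m1 m1E] : exists m1, mu1 setT = m1%:E.
  by exists (fine (mu1 setT)); rewrite fineK // fin_num_measure.
have [m2 m2E] : exists m2, mu2 setT = m2%:E.
  by exists (fine (mu2 setT)); rewrite fineK // fin_num_measure.
rewrite -(fineK IHfin) m1E m2E /= -!EFinM -!EFinD !lee_fin; lra.
Qed.

End weak_duality.

(** * Nearly optimal plans and step potentials *)

Lemma step_function_integral d (T : measurableType d) (R : realType)
    (mu : {finite_measure set T -> \bar R}) (I : finType) (A : I -> set T)
    (c : I -> R) : (forall i, measurable (A i)) ->
  let f x := \sum_i c i * \1_(A i) x in
  mu.-integrable setT (EFin \o f) /\
  \int[mu]_x f x = \sum_i c i * fine (mu (A i)).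
Proof.
move=> mA /=; elim: (index_enum I) => [|i s [IH1 IH2]].
  rewrite big_nil; under [X in Rintegral _ _ X]eq_fun do rewrite big_nil.
  split; last by rewrite Rintegral_cst // mul0r.
  apply: (eq_integrable measurableT (fun=> 0%E)); last exact: integrable0.
  by move=> x _ /=; rewrite big_nil.
have I1 : mu.-integrable setT (EFin \o (fun x => \1_(A i) x : R)) by exact: integrable_indic.
have Ic : mu.-integrable setT (EFin \o (fun x => c i * \1_(A i) x)).
  exact: (integrableZl measurableT (c i) I1).
have -> : (fun x => \sum_(j <- i :: s) c j * \1_(A j) x) =
    (fun x => c i * \1_(A i) x + \sum_(j <- s) c j * \1_(A j) x).
  by apply/funext => x; rewrite big_cons.
split; first exact: (integrableD measurableT Ic IH1).
rewrite RintegralD // IH2 big_cons RintegralZl //.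
by rewrite /Rintegral integral_indic // setIT.
Qed.

Lemma step_function_value (T : Type) (R : realType) (I : finType) (A : I -> set T)
    (c : I -> R) i x : (forall i j y, A i y -> A j y -> i = j) -> A i x ->
  \sum_j c j * \1_(A j) x = c i.
Proof.
move=> dA Ax; rewrite (bigD1 i) //= big1 ?addr0 => [|j ji].
  by rewrite indicE mem_set // mulr1.
rewrite indicE memNset ?mulr0 // => Ajx; move: ji.
by rewrite (dA _ _ _ Ajx Ax) eqxx.
Qed.

Section homogeneous_cost.
Variables (R : realType) (X Y : ptopologicalType) (h : X -> Y -> R -> R -> R).
Hypotheses (cptY : compact [set: Y]).
Hypothesis h_cont :
  continuous (fun q : X * (Y * (R * R)) => h q.1 q.2.1 q.2.2.1 q.2.2.2).
Hypothesis h_hom : forall x y a b l, 0 <= a -> 0 <= b -> 0 < l ->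
  h x y (l * a) (l * b) = l * h x y a b.

Definition small_oscillation (e : R) (U : set X) := forall x x' y a b,
  U x -> U x' -> 0 <= a -> 0 <= b -> h x y a b <= h x' y a b + e * (a + b).

(** Uniform continuity for radii (s, t) with s + t = 1, extended to all radii by
    homogeneity. *)
Lemma small_oscillation_nbhs (e : R) (x : X) : 0 < e ->
  exists U, [/\ open U, U x & small_oscillation e U].
Proof.
move=> e0; have e20 : 0 < e / 2 by rewrite divr_gt0.
have near_x := cost_near cptY h_cont x 1 e20.
exists [set x' | forall y a b, 0 <= a <= 1 -> 0 <= b <= 1 ->
  `|h x' y a b - h x y a b| < e / 2]°.
split=> [||x1 x2 y a b /interior_subset /= h1 /interior_subset /= h2 a0 b0].
- exact: open_interior.
- exact: near_x.
have : 0 <= a + b by exact: addr_ge0.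
rewrite le_eqVlt => /predU1P[ab0|ab0].
  have [-> ->] : a = 0 /\ b = 0 by lra.
  have hom0 z : h z y 0 0 = 0.
    by have := h_hom z y (lexx 0) (lexx 0) (ltr0Sn R 1); rewrite mulr0; lra.
  by rewrite !hom0 addr0 mulr0 addr0.
pose s := a / (a + b); pose t := b / (a + b).
have s01 : 0 <= s <= 1 by rewrite divr_ge0 ?(ltW ab0) //= ler_pdivrMr // mul1r; lra.
have t01 : 0 <= t <= 1 by rewrite divr_ge0 ?(ltW ab0) //= ler_pdivrMr // mul1r; lra.
have [s0 t0] : 0 <= s /\ 0 <= t by case/andP: s01; case/andP: t01.
have scale z : h z y a b = (a + b) * h z y s t.
  by rewrite -h_hom //; congr (h _ _ _ _); rewrite /s /t mulrC divfK // gt_eqF.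
rewrite !scale [e * _]mulrC -mulrDr ler_pM2l //.
have := h1 y s t s01 t01; have := h2 y s t s01 t01.
by rewrite !ltr_norml => /andP[? ?] /andP[? ?]; lra.
Qed.

End homogeneous_cost.

Definition full_measure (R : realType) (X : ptopologicalType)
    (mu : set (borel X) -> \bar R) (E : set X) :=
  measurable (E : set (borel X)) /\ mu (~` E) = 0%E.

Definition feasible_on (R : realType) (X Y : Type) (h : X -> Y -> R -> R -> R)
    (E1 : set X) (E2 : set Y) (psi1 : X -> R) (psi2 : Y -> R) :=
  forall x y a b, E1 x -> E2 y -> 0 <= a -> 0 <= b ->
    psi1 x * a + psi2 y * b <= h x y a b.

Lemma swap_cost_continuous (R : realType) (X Y : topologicalType) (h : X -> Y -> R -> R -> R) :
  continuous (fun q : X * (Y * (R * R)) => h q.1 q.2.1 q.2.2.1 q.2.2.2) ->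
  continuous (fun q : Y * (X * (R * R)) => h q.2.1 q.1 q.2.2.2 q.2.2.1).
Proof.
move=> ch; pose g (q : Y * (X * (R * R))) := (q.2.1, (q.1, (q.2.2.2, q.2.2.1))).
have c2 := @snd_continuous Y (X * (R * R))%type.
have c22 := continuous_comp_global c2 (@snd_continuous X (R * R)%type).
have cg : continuous g.
  apply: (@pair_continuous _ _ _ (fun q => q.2.1)).
    exact: continuous_comp_global c2 (@fst_continuous X (R * R)%type).
  apply: (@pair_continuous _ _ _ (fun q => q.1)); first exact: fst_continuous.
  apply: (@pair_continuous _ _ _ (fun q => q.2.2.2)).
    exact: continuous_comp_global c22 (@snd_continuous R R).
  exact: continuous_comp_global c22 (@fst_continuous R R).
exact: (continuous_comp_global cg ch).
Qed.

Section near_optimal.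
Variables (R : realType) (X1 X2 : ptopologicalType).
Hypotheses (metX1 : metrizable R X1) (metX2 : metrizable R X2).
Hypotheses (cptX1 : compact [set: X1]) (cptX2 : compact [set: X2]).
Variable H : cone R X1 * cone R X2 -> R.
Hypotheses (H_ge0 : forall p, 0 <= H p) (H_cont : continuous H).
Hypotheses (H_hom : radially_homogeneous H) (H_conv : radially_convex H).
Variable mu1 : {finite_measure set (borel X1) -> \bar R}.
Variable mu2 : {finite_measure set (borel X2) -> \bar R}.
Hypotheses (mu1_gt0 : (0 < mu1 setT)%E) (mu2_gt0 : (0 < mu2 setT)%E).

Definition cone_cost (x : X1) (y : X2) (a b : R) : R :=
  H (cone_pt R x a, cone_pt R y b).

Lemma cone_cost_continuous :
  continuous (fun q : X1 * (X2 * (R * R)) => cone_cost q.1 q.2.1 q.2.2.1 q.2.2.2).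
Proof.
pose g (q : X1 * (X2 * (R * R))) := (cone_pt R q.1 q.2.2.1, cone_pt R q.2.1 q.2.2.2).
have c2 := @snd_continuous X1 (X2 * (R * R))%type.
have c22 := continuous_comp_global c2 (@snd_continuous X2 (R * R)%type).
have cg : continuous g.
  apply: pair_continuous.
    apply: (@continuous_comp_global _ _ _ (fun q : X1 * (X2 * (R * R)) => (q.1, q.2.2.1)) _
      _ (@cone_pt_continuous R X1)).
    apply: (@pair_continuous _ _ _ (fun q => q.1)); first exact: fst_continuous.
    exact: continuous_comp_global c22 (@fst_continuous R R).
  apply: (@continuous_comp_global _ _ _ (fun q : X1 * (X2 * (R * R)) => (q.2.1, q.2.2.2)) _
    _ (@cone_pt_continuous R X2)).
  apply: (@pair_continuous _ _ _ (fun q => q.2.1)).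
    exact: continuous_comp_global c2 (@fst_continuous X2 (R * R)%type).
  exact: continuous_comp_global c22 (@snd_continuous R R).
exact: (continuous_comp_global cg H_cont).
Qed.

Lemma cone_cost_hom x y a b l : 0 <= a -> 0 <= b -> 0 < l ->
  cone_cost x y (l * a) (l * b) = l * cone_cost x y a b.
Proof. exact: H_hom. Qed.

Lemma cone_cost_subadditive x y a b a' b' : 0 <= a -> 0 <= b -> 0 <= a' -> 0 <= b' ->
  cone_cost x y (a + a') (b + b') <= cone_cost x y a b + cone_cost x y a' b'.
Proof.
move=> a0 b0 a'0 b'0.
have half0 : (0 : R) <= 2^-1 by rewrite invr_ge0.
have half1 : (2^-1 : R) <= 1 by rewrite invf_le1 // ler1n.
pose t : {i01 R} := Itv01 half0 half1.
have A1 : ((a, b) : (R^o * R^o)%type) \in [set r : (R^o * R^o)%type | 0 <= r.1 /\ 0 <= r.2].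
  by rewrite inE.
have A2 : ((a', b') : (R^o * R^o)%type) \in [set r : (R^o * R^o)%type | 0 <= r.1 /\ 0 <= r.2].
  by rewrite inE.
have : cone_cost x y (2^-1 * a + (1 - 2^-1) * a') (2^-1 * b + (1 - 2^-1) * b') <=
    2^-1 * cone_cost x y a b + (1 - 2^-1) * cone_cost x y a' b'.
  exact: (H_conv x y t A1 A2).
have -> : (1 - 2^-1 : R) = 2^-1 by lra.
rewrite -!mulrDr cone_cost_hom ?addr_ge0 ?invr_gt0 //.
by rewrite ler_pM2l // invr_gt0.
Qed.

Let positive_nonempty (X : ptopologicalType) (mu : {finite_measure set (borel X) -> \bar R})
  (A : set X) : (0 < mu A)%E -> A !=set0.
Proof. by move=> A0; apply/set0P/eqP => AE; move: A0; rewrite AE measure0 ltxx. Qed.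

Let partition_inhabited (X : ptopologicalType) (mu : {finite_measure set (borel X) -> \bar R})
  (I : finType) (A : I -> set X) : (0 < mu setT)%E ->
  mu (~` \bigcup_i A i) = 0%E -> inhabited I.
Proof.
move=> mu0 null; apply: contrapT => nI.
have : (~` \bigcup_i A i) = setT.
  by apply/seteqP; split=> // x _ [i _ _]; apply: nI.
by move=> E; move: mu0; rewrite -E null ltxx.
Qed.

(** Replacing h by its values at the base points p i and q j of the cells costs
    2 d (s + t) at radii (s, t).  This is paid once in the plan and once in the
    potentials, hence 4 d (mu1 X1 + mu2 X2) in total, plus the error d of
    the finite duality. *)
Lemma near_optimal_steps (e : R) : 0 < e -> exists E1 E2 psi1 psi2,
  [/\ full_measure mu1 E1 /\ full_measure mu2 E2,
      mu1.-integrable setT (EFin \o psi1) /\ mu2.-integrable setT (EFin \o psi2),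
      feasible_on cone_cost E1 E2 psi1 psi2 &
      (UH H mu1 mu2 <= (\int[mu1]_x psi1 x + \int[mu2]_y psi2 y + e)%:E)%E].
Proof.
move=> e0; pose M1 := fine (mu1 setT); pose M2 := fine (mu2 setT).
have M1_ge0 : 0 <= M1 by rewrite fine_ge0.
have M2_ge0 : 0 <= M2 by rewrite fine_ge0.
(* the total error d + 4 d (M1 + M2) has to equal e *)
pose d := e / (1 + 4 * (M1 + M2)).
have D0 : 0 < 1 + 4 * (M1 + M2) by lra.
have d0 : 0 < d by rewrite divr_gt0.
have dE : d + 4 * d * (M1 + M2) = e.
  have <- : d * (1 + 4 * (M1 + M2)) = e by rewrite divfK // gt_eqF.
  by ring.
pose Q1 := small_oscillation cone_cost d.
pose Q2 := small_oscillation (fun y x b a => cone_cost x y a b) d.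
have Qsub (X Y : ptopologicalType) (k : X -> Y -> R -> R -> R) A B :
    A `<=` B -> small_oscillation k d B -> small_oscillation k d A.
  by move=> AB oB x x' y a b Ax Ax'; apply: oB; exact: AB.
have [I [A [mA A0 A_osc dA A_full]]] := finite_positive_partition mu1 cptX1
  (@Qsub _ _ cone_cost) (fun x =>
    small_oscillation_nbhs cptX2 cone_cost_continuous cone_cost_hom x d0).
have hom' y x b a l : 0 <= b -> 0 <= a -> 0 < l ->
  cone_cost x y (l * a) (l * b) = l * cone_cost x y a b.
  by move=> b0 a0; exact: cone_cost_hom.
have [J [B [mB B0 B_osc dB B_full]]] := finite_positive_partition mu2 cptX2
  (@Qsub _ _ (fun y x b a => cone_cost x y a b))
  (fun y => small_oscillation_nbhs cptX1 (swap_cost_continuous cone_cost_continuous) hom' y d0).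
have /choice[p Ap] i : exists x, A i x by exact: positive_nonempty (A0 i).
have /choice[q Bq] j : exists y, B j y by exact: positive_nonempty (B0 j).
have [i0] := partition_inhabited mu1_gt0 A_full.
have [j0] := partition_inhabited mu2_gt0 B_full.
pose m i := fine (mu1 (A i)); pose n j := fine (mu2 (B j)).
have m_gt0 i : 0 < m i by rewrite fine_gt0 // A0 ltey_eq fin_num_measure.
have n_gt0 j : 0 < n j by rewrite fine_gt0 // B0 ltey_eq fin_num_measure.
pose k i j := cone_cost (p i) (q j).
have k_ge0 i j a b : 0 <= a -> 0 <= b -> 0 <= k i j a b by move=> _ _; exact: H_ge0.
have k_sub i j a b a' b' : 0 <= a -> 0 <= b -> 0 <= a' -> 0 <= b' ->
  k i j (a + a') (b + b') <= k i j a b + k i j a' b' by exact: cone_cost_subadditive.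
have k_hom i j a b l : 0 <= a -> 0 <= b -> 0 < l ->
  k i j (l * a) (l * b) = l * k i j a b by exact: cone_cost_hom.
pose w (o : I + J) := match o with inl i => m i | inr j => n j end.
have w_gt0 o : 0 < w o by case: o.
have [a [b [u [v [[a_ge0 b_ge0 a_sum b_sum] uv cost_le]]]]] :=
  finite_duality i0 j0 k_ge0 k_sub k_hom w_gt0 d0.
have cell x y i j s t : A i x -> B j y -> 0 <= s -> 0 <= t ->
    cone_cost x y s t <= k i j s t + 2 * d * (s + t) /\
    k i j s t <= cone_cost x y s t + 2 * d * (s + t).
  move=> Ax By s0 t0.
  have := A_osc i x (p i) y s t Ax (Ap i) s0 t0.
  have := A_osc i (p i) x y s t (Ap i) Ax s0 t0.
  have := B_osc j y (q j) (p i) t s By (Bq j) t0 s0.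
  have := B_osc j (q j) y (p i) t s (Bq j) By t0 s0.
  by rewrite /k; split; lra.
have mn_gt0 i j : 0 < m i * n j by exact: mulr_gt0.
pose c i j := k i j (a i j) (b i j) + 2 * d * (a i j + b i j).
have H_le i j x y : A i x -> B j y ->
  H (cone_pt R x (a i j / (m i * n j)), cone_pt R y (b i j / (m i * n j))) <=
  c i j / (m i * n j).
  move=> Ax By; have il0 : 0 < (m i * n j)^-1 by rewrite invr_gt0.
  rewrite [a i j / _]mulrC [b i j / _]mulrC [c i j / _]mulrC.
  rewrite [leLHS]cone_cost_hom // ler_pM2l //.
  by have [] := cell x y i j _ _ Ax By (a_ge0 i j) (b_ge0 i j).
have H00 : H (vertex R X1, vertex R X2) = 0.
  have := H_hom (point : X1) (point : X2) (lexx 0) (lexx 0) (ltr0Sn R 1).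
  by rewrite mulr0 !cone_pt0; lra.
have [alpha alphaP alpha_le] := discrete_plan metX1 metX2 cptX1 cptX2 H_ge0 H_cont H00
  mA mB A0 B0 dA dB A_full B_full a_ge0 b_ge0 a_sum b_sum H_le.
have mass (X : ptopologicalType) (mu : {finite_measure set (borel X) -> \bar R})
    (K : finType) (F : K -> set X) : (forall k, measurable (F k : set (borel X))) ->
    (forall k k' x, F k x -> F k' x -> k = k') -> mu (~` \bigcup_k F k) = 0%E ->
    fine (mu setT) = \sum_k fine (mu (F k)).
  move=> mF dF nF; rewrite (measure_partition mF dF nF measurableT).
  under eq_bigr do rewrite setTI.
  rewrite -sum_fine // => k' _; exact: fin_num_measure.
have [Ipsi1 psi1E] := step_function_integral mu1 (fun i => u i - 2 * d) mA.
have [Ipsi2 psi2E] := step_function_integral mu2 (fun j => v j - 2 * d) mB.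
exists (\bigcup_i A i), (\bigcup_j B j).
exists (fun x => \sum_i (u i - 2 * d) * \1_(A i) x).
exists (fun y => \sum_j (v j - 2 * d) * \1_(B j) y); split=> //.
- by split; split=> //; exact: fin_bigcup_measurable.
- move=> x y s t [i _ Ax] [j _ By] s0 t0.
  rewrite (step_function_value _ dA Ax) (step_function_value _ dB By).
  have [_] := cell x y i j _ _ Ax By s0 t0; have := uv i j s t s0 t0; lra.
- apply: (@le_trans _ _ (\sum_i \sum_j c i j)%:E).
    apply: le_trans alpha_le; apply: ereal_inf_lbound; by exists alpha.
  have M1E : M1 = \sum_i m i by exact: mass mA dA A_full.
  have M2E : M2 = \sum_j n j by exact: mass mB dB B_full.
  have cE : \sum_i \sum_j c i j = total_cost k a b + 2 * d * (M1 + M2).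
    rewrite /c /total_cost; under eq_bigr do rewrite big_split /=.
    rewrite big_split /=; congr (_ + _).
    under eq_bigr do rewrite -mulr_sumr big_split /=.
    rewrite -mulr_sumr big_split /= M1E M2E; congr (_ * (_ + _)).
      by apply: eq_bigr => i _; exact: a_sum.
    by rewrite exchange_big; apply: eq_bigr => j _; exact: b_sum.
  rewrite lee_fin cE psi1E psi2E.
  have -> : \sum_i (u i - 2 * d) * m i = \sum_i u i * m i - 2 * d * M1.
    by rewrite M1E mulr_sumr -sumrB; apply: eq_bigr => i _; rewrite mulrBl.
  have -> : \sum_j (v j - 2 * d) * n j = \sum_j v j * n j - 2 * d * M2.
    by rewrite M2E mulr_sumr -sumrB; apply: eq_bigr => i _; rewrite mulrBl.
  move: cost_le; rewrite /w; lra.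
Qed.

End near_optimal.

(** * Existence of optimal potentials *)

Section potentials.
Variables (R : realType) (X1 X2 : ptopologicalType).
Hypotheses (metX1 : metrizable R X1) (metX2 : metrizable R X2).
Hypotheses (cptX1 : compact [set: X1]) (cptX2 : compact [set: X2]).
Variable H : cone R X1 * cone R X2 -> R.
Hypotheses (H_ge0 : forall p, 0 <= H p) (H_cont : continuous H).
Hypotheses (H_hom : radially_homogeneous H) (H_conv : radially_convex H).
Variable Omega : set (X1 * X2).
Hypotheses (Omega_open : open Omega)
  (Omega_fst : fst @` Omega = [set: X1]) (Omega_snd : snd @` Omega = [set: X2]).
Hypothesis slope1 : forall x1 x2, Omega (x1, x2) ->
  (H (cone_pt R x1 r, cone_pt R x2 1) - H (vertex R X1, cone_pt R x2 1)) / r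
    @[r --> 0^'+] --> -oo.
Hypothesis slope2 : forall x1 x2, Omega (x1, x2) ->
  (H (cone_pt R x1 1, cone_pt R x2 r) - H (cone_pt R x1 1, vertex R X2)) / r
    @[r --> 0^'+] --> -oo.
Variable mu1 : {finite_measure set (borel X1) -> \bar R}.
Variable mu2 : {finite_measure set (borel X2) -> \bar R}.
Hypotheses (supp1 : supp mu1 = [set: X1]) (supp2 : supp mu2 = [set: X2]).

Local Notation h := (cone_cost H).
Local Notation h' := (fun y x b a => cone_cost H x y a b).

Let h_cont := cone_cost_continuous H_cont.
Let h_cont' := swap_cost_continuous h_cont.
Let h_ge0 x y a b : 0 <= a -> 0 <= b -> 0 <= h x y a b.
Proof. by move=> _ _; exact: H_ge0. Qed.
Let h_ge0' y x b a : 0 <= b -> 0 <= a -> 0 <= h x y a b.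
Proof. by move=> _ _; exact: H_ge0. Qed.
Let h_hom x y a b l : 0 <= a -> 0 <= b -> 0 < l ->
  h x y (l * a) (l * b) = l * h x y a b.
Proof. exact: H_hom. Qed.
Let h_hom' y x b a l : 0 <= b -> 0 <= a -> 0 < l ->
  h x y (l * a) (l * b) = l * h x y a b.
Proof. by move=> b0 a0; exact: H_hom. Qed.
Let h_vertex x x' y b : h x y 0 b = h x' y 0 b.
Proof. by rewrite /cone_cost !cone_pt0. Qed.
Let h_vertex' y y' x a : h x y a 0 = h x y' a 0.
Proof. by rewrite /cone_cost !cone_pt0. Qed.

Let h_slope : exists Om : set (X1 * X2),
  [/\ open Om, snd @` Om = [set: X2] & forall x y, Om (x, y) ->
      (h x y r 1 - h x y 0 1) / r @[r --> 0^'+] --> -oo].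
Proof.
exists Omega; split=> // x y Oxy.
by rewrite {2}/cone_cost cone_pt0; exact: slope1.
Qed.

Let h_slope' : exists Om : set (X2 * X1),
  [/\ open Om, snd @` Om = [set: X1] & forall y x, Om (y, x) ->
      (h' y x r 1 - h' y x 0 1) / r @[r --> 0^'+] --> -oo].
Proof.
exists [set q | Omega (q.2, q.1)]; split.
- apply: (@open_comp _ _ (fun q : X2 * X1 => (q.2, q.1)) Omega) => // q _.
  exact: (pair_continuous (@snd_continuous X2 X1) (@fst_continuous X2 X1)).
- apply/seteqP; split=> // x _; have : [set: X1] x by [].
  by rewrite -Omega_fst => -[[x' y] /= Oxy <-]; exists (y, x').
- by move=> y x /= Oxy; rewrite {2}/cone_cost cone_pt0; exact: slope2.
Qed.

Let supp_gt0 (X : ptopologicalType) (mu : {finite_measure set (borel X) -> \bar R}) :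
  supp mu = [set: X] -> (0 < mu setT)%E.
Proof.
move=> sX; have sp : supp mu point by rewrite sX.
exact: (sp setT openT Logic.I).
Qed.

Let full_nonempty (X : ptopologicalType) (mu : {finite_measure set (borel X) -> \bar R})
  (E : set X) : supp mu = [set: X] -> full_measure mu E -> E !=set0.
Proof.
move=> sX [mE E0]; apply/set0P/eqP => EE; move: (supp_gt0 sX).
by rewrite -setC0 -EE E0 ltxx.
Qed.

Let UH_ge0 : (0 <= UH H mu1 mu2)%E.
Proof.
apply: le_ereal_inf_tmp => _ [alpha _ <-].
by apply: integral_ge0 => p _; rewrite lee_fin.
Qed.

(** Since U_H >= 0 and both potentials are bounded above, near optimality bounds
    both integrals from below, and each potential keeps a uniform gap.  The gap
    of psi2 makes its conjugate phi1 well behaved; phi1 is compatible with psi2,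
    so it has a gap as well, and its conjugate phi2 is well behaved too.  The
    constants M, r1, r2 do not depend on e, which gives equicontinuity. *)
Lemma near_optimal_potentials : exists M r1 r2 : R, forall e : R, 0 < e -> e <= 1 ->
  exists phi1 phi2, [/\ feasible_on h setT setT phi1 phi2,
    (forall x, `|phi1 x| <= M) /\ (forall y, `|phi2 y| <= M),
    forall x x' eta, (forall y s, 0 <= s <= r1 -> `|h x y 1 s - h x' y 1 s| <= eta) ->
      phi1 x <= phi1 x' + eta,
    forall y y' eta, (forall x s, 0 <= s <= r2 -> `|h x y s 1 - h x y' s 1| <= eta) ->
      phi2 y <= phi2 y' + eta &
    (continuous phi1 -> continuous phi2 ->
      (UH H mu1 mu2 <= (\int[mu1]_x phi1 x + \int[mu2]_y phi2 y + e)%:E)%E)].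
Proof.
have [C C0 hC] := cost_bounded cptX1 cptX2 h_cont.
pose L := 1 + C * (fine (mu1 setT) + fine (mu2 setT)).
have CM1 : 0 <= C * fine (mu1 setT) by rewrite mulr_ge0 // fine_ge0.
have CM2 : 0 <= C * fine (mu2 setT) by rewrite mulr_ge0 // fine_ge0.
have L0 : 0 <= L by rewrite /L mulrDr; lra.
have [d2 d20 gap2] := uniform_gap cptX1 cptX2 h_cont h_vertex h_slope supp1 L0.
have [d1 d10 gap1] := uniform_gap cptX2 cptX1 h_cont' h_vertex' h_slope' supp2 L0.
have [r1 [N1 conj1]] := conjugate_bounds cptX1 cptX2 h_cont h_ge0 h_hom d20.
have [r2 [N2 conj2]] := conjugate_bounds cptX2 cptX1 h_cont' h_ge0' h_hom' d10.
exists (Num.max N1 N2), r1, r2 => e e0 e1.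
have [E1 [E2 [psi1 [psi2 [[full1 full2] [I1 I2] feas UHe]]]]] :=
  near_optimal_steps metX1 metX2 cptX1 cptX2 H_ge0 H_cont H_hom H_conv
    (supp_gt0 supp1) (supp_gt0 supp2) e0.
have [x0 E1x0] := full_nonempty supp1 full1.
have [y0 E2y0] := full_nonempty supp2 full2.
have upper1 : \int[mu1]_x psi1 x <= C * fine (mu1 setT).
  rewrite -Rintegral_cst //; apply: (le_Rintegral_full full1.1 full1.2 I1).
    exact: finite_measure_integrable_cst.
  move=> x Ex; have := feas x y0 1 0 Ex E2y0 ler01 (lexx 0).
  by have := hC x y0 1 0; rewrite !lexx !ler01; lra.
have upper2 : \int[mu2]_y psi2 y <= C * fine (mu2 setT).
  rewrite -Rintegral_cst //; apply: (le_Rintegral_full full2.1 full2.2 I2).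
    exact: finite_measure_integrable_cst.
  move=> y Ey; have := feas x0 y 0 1 E1x0 Ey (lexx 0) ler01.
  by have := hC x0 y 0 1; rewrite !lexx !ler01; lra.
have := le_trans UH_ge0 UHe; rewrite lee_fin => sum_ge0.
have lower1 : - L <= \int[mu1]_x psi1 x by rewrite /L mulrDr; lra.
have lower2 : - L <= \int[mu2]_y psi2 y by rewrite /L mulrDr; lra.
have psi2_gap x y : E2 y -> psi2 y + d2 <= h x y 0 1.
  move=> Ey; apply: (gap2 E1 psi1); split=> //; [exact: full1.1|exact: full1.2|].
  by move=> z a b Ez; exact: feas.
have [phi1_feas phi1_bd phi1_max phi1_mod] := conj1 E2 psi2 (ex_intro _ y0 E2y0) psi2_gap.
pose phi1 := conjugate h E2 psi2.
have phi1_gap y x : [set: X1] x -> phi1 x + d1 <= h x y 1 0.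
  move=> _; apply: (gap1 E2 psi2); split=> //; [exact: full2.1|exact: full2.2|].
  by move=> z b a Ez b0 a0; rewrite addrC; exact: phi1_feas.
have [phi2_feas phi2_bd phi2_max phi2_mod] := conj2 setT phi1 (ex_intro _ x0 Logic.I) phi1_gap.
pose phi2 := conjugate h' setT phi1.
exists phi1, phi2; split=> //.
- by move=> x y a b _ _ a0 b0; rewrite addrC; exact: phi2_feas.
- by split=> [x|y]; rewrite le_max ?phi1_bd ?phi2_bd ?orbT.
move=> c1 c2; apply: (le_trans UHe); rewrite lee_fin lerD2r; apply: lerD.
  apply: (le_Rintegral_full full1.1 full1.2 I1).
    exact: continuous_bounded_integrable c1 phi1_bd.
  by move=> x Ex; apply: phi1_max => y a b Ey; exact: feas.
apply: (le_Rintegral_full full2.1 full2.2 I2).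
  exact: continuous_bounded_integrable c2 phi2_bd.
by move=> y Ey; apply: phi2_max => x b a _ b0 a0; rewrite addrC; exact: phi1_feas.
Qed.

Lemma modulus_equicontinuous (X Y : ptopologicalType) (k : X -> Y -> R -> R -> R)
    (r : R) (x0 : X) (eta : R) : compact [set: Y] ->
  continuous (fun q : X * (Y * (R * R)) => k q.1 q.2.1 q.2.2.1 q.2.2.2) -> 0 < eta ->
  \forall x \near x0, forall phi : X -> R,
    (forall x x' eta, (forall y s, 0 <= s <= r -> `|k x y 1 s - k x' y 1 s| <= eta) ->
      phi x <= phi x' + eta) -> `|phi x - phi x0| <= eta.
Proof.
move=> cY ck eta0; apply: filterS (cost_near cY ck x0 (Num.max 1 r) eta0) => x near_x phi phiP.
have close y s : 0 <= s <= r -> `|k x y 1 s - k x0 y 1 s| <= eta.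
  move=> /andP[s0 sr]; apply: ltW; apply: near_x; rewrite ?le_max ?lexx ?ler01 //.
  by rewrite s0 sr orbT.
have := phiP x x0 eta close.
have := phiP x0 x eta; rewrite ler_norml => /(_ _) h1 h2; apply/andP; split; last by lra.
suff : phi x0 <= phi x + eta by lra.
by apply: h1 => y s sr; rewrite distrC; exact: close.
Qed.

(** The limit along an ultrafilter of the pairs belonging to e = 1 / (n + 1). *)
Lemma optimal_potentials : exists phi1 phi2 (M : R),
  [/\ continuous phi1 /\ continuous phi2,
      (forall x, `|phi1 x| <= M) /\ (forall y, `|phi2 y| <= M),
      feasible_on h setT setT phi1 phi2 &
      (UH H mu1 mu2 <= (\int[mu1]_x phi1 x + \int[mu2]_y phi2 y)%:E)%E].
Proof.
have [M [r1 [r2 pot]]] := near_optimal_potentials.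
pose e (n : nat) : R := n.+1%:R^-1.
have e0 n : 0 < e n by rewrite invr_gt0.
have e1 n : e n <= 1 by rewrite invf_le1 // ler1n.
have /choice[f1 /choice[f2 fP]] n := pot (e n) (e0 n) (e1 n).
have eq1 x0 (eta : R) : 0 < eta -> \forall x \near x0, forall n, `|f1 n x - f1 n x0| <= eta.
  move=> eta0; apply: filterS (modulus_equicontinuous r1 x0 cptX2 h_cont eta0) => x hx n.
  by apply: hx; have [] := fP n.
have eq2 y0 (eta : R) : 0 < eta -> \forall y \near y0, forall n, `|f2 n y - f2 n y0| <= eta.
  move=> eta0.
  apply: filterS (@modulus_equicontinuous _ _ h' r2 y0 _ cptX1 h_cont' eta0) => y hy n.
  by apply: hy; have [_ _ _ mod2 _] := fP n; exact: mod2.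
have cont (X : ptopologicalType) (g : nat -> X -> R) :
    (forall x0 (eta : R), 0 < eta -> \forall x \near x0, forall n, `|g n x - g n x0| <= eta) ->
    forall n, continuous (g n).
  move=> eqg n x0; apply/cvgrPdist_le => eta eta0.
  by apply: filterS (eqg x0 eta eta0) => x gx; rewrite distrC.
have cf1 := cont _ f1 eq1; have cf2 := cont _ f2 eq2.
have [F [UF sF]] := ultraFilterLemma (@eventually_filter).
have bd1 n x : `|f1 n x| <= M by have [_ [fM _] _ _ _] := fP n; exact: fM.
have bd2 n y : `|f2 n y| <= M by have [_ [_ fM] _ _ _] := fP n; exact: fM.
have [phi1 [c1 M1 lim1 unif1]] := equicontinuous_ultralimit cptX1 UF bd1 eq1.
have [phi2 [c2 M2 lim2 unif2]] := equicontinuous_ultralimit cptX2 UF bd2 eq2.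
have PF : ProperFilter F by exact: ultra_proper.
exists phi1, phi2, M; split=> //.
  move=> x y a b _ _ a0 b0.
  have lim : f1 n x * a + f2 n y * b @[n --> F] --> phi1 x * a + phi2 y * b.
    by apply: cvgD; apply: cvgM; [exact: lim1|exact: cvg_cst|exact: lim2|exact: cvg_cst].
  apply: (cvgr_to_le lim); apply: nearW => n; have [feas _ _ _ _] := fP n; exact: feas.
pose m := fine (mu1 setT) + fine (mu2 setT) + 1.
have m0 : 0 < m by rewrite ltr_wpDl // addr_ge0 // fine_ge0.
(* an error eta / m per unit of mass and for e n adds up to eta *)
apply/lee_addgt0Pr => eta eta0; have etam0 : 0 < eta / m by rewrite divr_gt0.
have near_int (X : ptopologicalType) (mu : {finite_measure set (borel X) -> \bar R})
    (f g : X -> R) : continuous f -> continuous g ->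
    (forall x, `|f x| <= M) -> (forall x, `|g x| <= M) ->
    (forall x, `|f x - g x| <= eta / m) ->
    \int[mu]_x f x <= \int[mu]_x g x + eta / m * fine (mu setT).
  move=> cf cg fM gM fg; have If := continuous_bounded_integrable mu cf fM.
  have Ig := continuous_bounded_integrable mu cg gM.
  have Ic : mu.-integrable setT (EFin \o (fun=> eta / m)).
    exact: finite_measure_integrable_cst.
  rewrite -Rintegral_cst // -RintegralD //; apply: le_Rintegral => //.
    exact: (integrableD measurableT Ig Ic).
  by move=> x _; have := fg x; rewrite ler_norml => /andP[_]; lra.
have nearF : \forall n \near F, e n <= eta / m.
  apply: sF; have [N _ hN] := near_infty_natSinv_lt (PosNum etam0).
  by exists N => // n Nn; apply: ltW; exact: hN.
near F => n.
have u1 : forall x, `|f1 n x - phi1 x| <= eta / m by near: n; exact: unif1.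
have u2 : forall y, `|f2 n y - phi2 y| <= eta / m by near: n; exact: unif2.
have en : e n <= eta / m by near: n.
have [_ _ _ _ UHn] := fP n.
apply: (le_trans (UHn (cf1 n) (cf2 n))); rewrite -EFinD lee_fin.
have i1 := near_int _ mu1 _ _ (cf1 n) c1 (bd1 n) M1 u1.
have i2 := near_int _ mu2 _ _ (cf2 n) c2 (bd2 n) M2 u2.
have etaE : eta / m * fine (mu1 setT) + eta / m * fine (mu2 setT) + eta / m = eta.
  by rewrite -mulrDr -[X in _ + X]mulr1 -mulrDr divfK // gt_eqF.
lra.
Unshelve. all: by end_near. Qed.

End potentials.

Theorem theorem7 (R : realType) (X1 X2 : ptopologicalType)
  (metX1 : metrizable R X1) (metX2 : metrizable R X2)
  (cptX1 : compact [set: X1]) (cptX2 : compact [set: X2])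
  (H : cone R X1 * cone R X2 -> R)
  (H_ge0 : forall p, 0 <= H p)
  (H_cont : continuous H)
  (H_hom : radially_homogeneous H)
  (H_conv : radially_convex H)
  (H_slope : exists Omega : set (X1 * X2),
    [/\ open Omega,
        fst @` Omega = [set: X1],
        snd @` Omega = [set: X2],
        forall (x1 : X1) (x2 : X2), Omega (x1, x2) ->
          (H (cone_pt R x1 r, cone_pt R x2 1)
            - H (vertex R X1, cone_pt R x2 1)) / r @[r --> 0^'+] --> -oo &
        forall (x1 : X1) (x2 : X2), Omega (x1, x2) ->
          (H (cone_pt R x1 1, cone_pt R x2 r)
            - H (cone_pt R x1 1, vertex R X2)) / r @[r --> 0^'+] --> -oo])
  (mu1 : {finite_measure set (borel X1) -> \bar R})
  (mu2 : {finite_measure set (borel X2) -> \bar R})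
  (radon1 : radon mu1) (radon2 : radon mu2)
  (supp1 : supp mu1 = [set: X1]) (supp2 : supp mu2 = [set: X2]) :
  exists2 phi : (X1 -> R) * (X2 -> R), Phi H phi &
    (\int[mu1]_x (phi.1 x)%:E + \int[mu2]_x (phi.2 x)%:E = UH H mu1 mu2)%E.
Proof.
have [Om [oO fO sO slope1 slope2]] := H_slope.
have [phi1 [phi2 [M [[c1 c2] [M1 M2] feas UHle]]]] := optimal_potentials metX1 metX2
  cptX1 cptX2 H_ge0 H_cont H_hom H_conv oO fO sO slope1 slope2 supp1 supp2.
have bounded (X : Type) (f : X -> R) : (forall x, `|f x| <= M) -> bounded_fun f.
  move=> fM; exists M; split; rewrite ?num_real // => z Mz x _.
  exact: le_trans (fM x) (ltW Mz).
have feasH x1 x2 r1 r2 : 0 <= r1 -> 0 <= r2 ->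
    phi1 x1 * r1 + phi2 x2 * r2 <= H (cone_pt R x1 r1, cone_pt R x2 r2).
  exact: feas.
exists (phi1, phi2); first by split=> //=; split=> //; exact: bounded.
have UHge := weak_duality H_ge0 H_cont mu1 mu2 c1 c2 M1 M2 feasH.
have I1 := continuous_bounded_integrable mu1 c1 M1.
have I2 := continuous_bounded_integrable mu2 c2 M2.
rewrite /=; apply/eqP; rewrite eq_le; apply/andP; split.
  by apply: le_trans UHge; rewrite EFinD /Rintegral !fineK // integrable_fin_num.
by apply: (le_trans UHle); rewrite EFinD /Rintegral !fineK // integrable_fin_num.
Qed.
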